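(* Let $M$ be a $Z$-free $E$-$E$-bimodule. Suppose $P$ and $P'$ are potentials in $\mathcal F_E(M)^{\geq3}$ such that $P'-P\in R(P)^2$. Then there is an algebra automorphism $\varphi$ of $\mathcal F_E(M)$, with $\varphi|_E=\mathrm{id}_E$, such that $\varphi(P)$ is cyclically equivalent to $P'$. Moreover, $\varphi(f)-f\in R(P)$ for all $f\in\mathcal F_E(M)$.
   Context: $F$ is a field, $E_1,\dots,E_n$ are finite-dimensional semisimple $F$-algebras, $E=\prod_{i=1}^nE_i$, $e_i\in E$ is the image of the identity of $E_i$, and $Z=\sum_i Fe_i\subseteq E$. All bimodules $M$ considered are finite-dimensional over $F$ with $F$ acting centrally. $\mathcal{F}_E(M)=\prod_{i\ge 0}M^{\otimes i}$ (tensor powers over $E$, $M^{\otimes0}=E$), with product $(fg)(i)=\sum_{s+t=i}f(s)g(t)$ ($f(i)$ is the degree $i$ component) and the topology of the metric $d(f,g)=2^{-\nu(f-g)}$, $\nu(h)=\min\{i:h(i)\ne0\}$. $\mathcal F_E(M)^{\ge i}$ is the set of $f$ with $f(j)=0$ for $j<i$. $T_E(M)\subseteq\mathcal F_E(M)$ is the tensor algebra. A potential is an element $P$ with $P=\sum_i e_iPe_i$. Two potentials are cyclically equivalent if their difference lies in $[\mathcal F_E(M),\mathcal F_E(M)]$, the closure of the $F$-span of all $fg-gf$ with $f,g\in\mathcal F_E(M)$. For a subset $B\subseteq\mathcal F_E(M)$, $B^2$ is the closure of the $F$-span of all products $fg$ with $f,g\in B$. $M$ is $Z$-free if there is a $Z$-$Z$-subbimodule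 $M_0$ such that the multiplication map $E\otimes_ZM_0\otimes_ZE\to M$ is an isomorphism of $E$-$E$-bimodules; such $M_0$ is fixed. Let $T=T_E(M)$ and let $\Delta:T\to T\otimes_ZT$ be the unique $F$-derivation with $\Delta(s)=1\otimes s-s\otimes1$ for $s\in E$ and $\Delta(m)=1\otimes m$ for $m\in M_0$. Let $u:T\otimes_ZT\to T$, $u(a\otimes b)=\sum_ie_ibae_i$. Put $\mathfrak h(f)(g)=u(\Delta(f)g)$ for $f,g\in T$, extended to $\mathcal F_E(M)$ by $\mathfrak h(f)(g)(l)=\sum_{i+j=l}\mathfrak h(f(i))(g(j))$, and $\delta(f)=\mathfrak h(f)(1)$. For $\psi\in M^*=\mathrm{Hom}_E(M_E,E_E)$, extend $\psi$ to $\mathcal F_E(M)$ by $\psi(s)=0$ for $s\in E$, $\psi(m_1\cdots m_l)=\psi(m_1)m_2\cdots m_l$, $\psi(f)=\sum_l\psi(f(l))$; put $\delta_\psi(f)=\psi(\delta(f))$. $R(P)$: choose an $F$-basis $A_{i,j}$ of each nonzero $e_iM_0e_j$, $A=\bigcup A_{i,j}$; for $a\in A_{i,j}$ write $\tau(a)=i$, $\sigma(a)=j$; choose an $F$-basis $L(i)$ of each $e_iE$. For $a\in A$, $s\in L(\tau(a))$, let $(sa)^*:M_E\to E$ be the right $E$-linear map with $(sa)^*(sa)=e_{\sigma(a)}$ and $(sa)^*(s'a')=0$ for all other products $s'a'$ ($a'\in A$, $s'\in L(\tau(a'))$). Put $X_{a^*}(P)=\sum_{s\in L(\tau(a))}\delta_{(sa)^*}(P)s$.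 $R(P)$ is the closure of the two-sided ideal of $\mathcal F_E(M)$ generated by all $X_{a^*}(P)$, $a\in A$ (it does not depend on the choices). *)

(* Defs.v *)
From HB Require Import structures.
From mathcomp Require Import all_boot all_algebra all_field.
From mathcomp Require Import boolp classical_sets.

Set Implicit Arguments.
Unset Strict Implicit.
Unset Printing Implicit Defensive.

Import GRing.Theory.
Local Open Scope ring_scope.

Section DProd.
Variables (F : fieldType) (I : Type) (V : I -> lmodType F).

Definition dprod : Type := forall i, V i.

HB.instance Definition _ := gen_eqMixin dprod.
HB.instance Definition _ := gen_choiceMixin dprod.

Let addd (f g : dprod) : dprod := fun i => f i + g i.
Let oppd (f : dprod) : dprod := fun i => - f i.
Let zerod : dprod := fun=> 0.
Let scaled (c : F) (f : dprod) : dprod := fun i => c *: f i.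

Fact dprod_addA : associative addd.
Proof. by move=> f g h; apply: functional_extensionality_dep => i; exact: addrA. Qed.
Fact dprod_addC : commutative addd.
Proof. by move=> f g; apply: functional_extensionality_dep => i; exact: addrC. Qed.
Fact dprod_add0 : left_id zerod addd.
Proof. by move=> f; apply: functional_extensionality_dep => i; exact: add0r. Qed.
Fact dprod_addN : left_inverse zerod oppd addd.
Proof. by move=> f; apply: functional_extensionality_dep => i; exact: addNr. Qed.

HB.instance Definition _ := GRing.isZmodule.Build dprod
  dprod_addA dprod_addC dprod_add0 dprod_addN.

Fact dprod_scaleA a b f : scaled a (scaled b f) = scaled (a * b) f.
Proof. by apply: functional_extensionality_dep => i; exact: scalerA. Qed.
Fact dprod_scale1 : left_id 1 scaled.
Proof. by move=> f; apply: functional_extensionality_dep => i; exact: scale1r. Qed.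
Fact dprod_scaleDr : right_distributive scaled +%R.
Proof. by move=> a f g; apply: functional_extensionality_dep => i; exact: scalerDr. Qed.
Fact dprod_scaleDl f : {morph scaled^~ f : a b / a + b}.
Proof. by move=> a b; apply: functional_extensionality_dep => i; exact: scalerDl. Qed.

HB.instance Definition _ := GRing.Zmodule_isLmodule.Build F dprod
  dprod_scaleA dprod_scale1 dprod_scaleDr dprod_scaleDl.

Lemma dprodP (f g : dprod) : (forall i, f i = g i) -> f = g.
Proof. exact: functional_extensionality_dep. Qed.
Lemma dprod0E i : (0 : dprod) i = 0. Proof. by []. Qed.
Lemma dprodDE (f g : dprod) i : (f + g) i = f i + g i. Proof. by []. Qed.
Lemma dprodNE (f : dprod) i : (- f) i = - f i. Proof. by []. Qed.
Lemma dprodZE c (f : dprod) i : (c *: f) i = c *: f i. Proof. by []. Qed.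
Lemma dprod_sumE (J : Type) (r : seq J) (P : pred J) (f : J -> dprod) i :
  (\sum_(j <- r | P j) f j) i = \sum_(j <- r | P j) f j i.
Proof. by elim/big_rec2: _ => // j y x _ <-. Qed.

End DProd.

Section ProdAlg.
Variables (F : fieldType) (n : nat) (E_ : 'I_n.+1 -> falgType F).

Definition prodalg : Type := dprod (fun i => E_ i : lmodType F).
HB.instance Definition _ := GRing.Lmodule.on prodalg.

Let oneE : prodalg := fun=> 1.
Let mulE (x y : prodalg) : prodalg := fun i => x i * y i.

Fact prodalg_mulA : associative mulE.
Proof. by move=> x y z; apply: dprodP => i; exact: mulrA. Qed.
Fact prodalg_mul1 : left_id oneE mulE.
Proof. by move=> x; apply: dprodP => i; exact: mul1r. Qed.
Fact prodalg_mulr1 : right_id oneE mulE.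
Proof. by move=> x; apply: dprodP => i; exact: mulr1. Qed.
Fact prodalg_mulDl : left_distributive mulE +%R.
Proof. by move=> x y z; apply: dprodP => i; exact: mulrDl. Qed.
Fact prodalg_mulDr : right_distributive mulE +%R.
Proof. by move=> x y z; apply: dprodP => i; exact: mulrDr. Qed.
Fact prodalg_1neq0 : oneE != 0.
Proof.
apply/eqP => /(congr1 (fun x : prodalg => x ord0)) /eqP.
by rewrite (negPf (oner_neq0 (E_ ord0))).
Qed.
HB.instance Definition _ := GRing.Zmodule_isNzRing.Build prodalg
  prodalg_mulA prodalg_mul1 prodalg_mulr1 prodalg_mulDl prodalg_mulDr
  prodalg_1neq0.

Fact prodalg_scaleAl (c : F) (x y : prodalg) : c *: (x * y) = (c *: x) * y.
Proof. by apply: dprodP => i; exact: scalerAl. Qed.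
HB.instance Definition _ :=
  GRing.Lmodule_isLalgebra.Build F prodalg prodalg_scaleAl.
Fact prodalg_scaleAr (c : F) (x y : prodalg) : c *: (x * y) = x * (c *: y).
Proof. by apply: dprodP => i; exact: scalerAr. Qed.
HB.instance Definition _ :=
  GRing.Lalgebra_isAlgebra.Build F prodalg prodalg_scaleAr.

Definition idem (i : 'I_n.+1) : prodalg := fun j => (i == j)%:R.

Definition Zsub : set prodalg :=
  [set z | exists c : 'I_n.+1 -> F, z = \sum_i c i *: idem i].
Definition Ztype : Type := {z : prodalg | Zsub z}.

End ProdAlg.

Section Semisimple.
Variables (F : fieldType) (A : falgType F).

Definition left_ideal (U : {vspace A}) := (fullv * U <= U)%VS.

Definition simple_left_ideal (U : {vspace A}) : Prop :=
  [/\ left_ideal U, U != 0%VS &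
      forall W : {vspace A}, left_ideal W -> (W <= U)%VS -> W = 0%VS \/ W = U].

Definition semisimple : Prop :=
  exists s : seq {vspace A},
    [/\ forall U, U \in s -> simple_left_ideal U,
        directv (\sum_(U <- s) U) & (\sum_(U <- s) U)%VS = fullv].

End Semisimple.

(* V (x)_S W for an F-space V with a right operation ra of S and an F-space W *)
(* with a left operation la of S: formal sums of pairs (v, w), modulo the     *)
(* smallest F-linear congruence making (v, w) |-> v (x) w F-bilinear and      *)
(* S-balanced. A scalar c acts on a formal sum through the first components.  *)
Section Tensor.
Variables (F : fieldType) (S : Type) (V W : lmodType F).
Variables (ra : V -> S -> V) (la : S -> W -> W).

Let fscale (c : F) (s : seq (V * W)) := [seq (c *: p.1, p.2) | p <- s].

Inductive tensor_eq : seq (V * W) -> seq (V * W) -> Prop :=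
| teq_refl s : tensor_eq s s
| teq_sym s t : tensor_eq s t -> tensor_eq t s
| teq_trans s t r : tensor_eq s t -> tensor_eq t r -> tensor_eq s r
| teq_cat s s' t t' :
    tensor_eq s s' -> tensor_eq t t' -> tensor_eq (s ++ t) (s' ++ t')
| teq_scale c s t : tensor_eq s t -> tensor_eq (fscale c s) (fscale c t)
| teq_catC s t : tensor_eq (s ++ t) (t ++ s)
| teq_0l w : tensor_eq [:: (0, w)] [::]
| teq_Dl v v' w : tensor_eq [:: (v + v', w)] [:: (v, w); (v', w)]
| teq_Dr v w w' : tensor_eq [:: (v, w + w')] [:: (v, w); (v, w')]
| teq_Z c v w : tensor_eq [:: (c *: v, w)] [:: (v, c *: w)]
| teq_bal v s w : tensor_eq [:: (ra v s, w)] [:: (v, la s w)].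

Let teqb (s t : seq (V * W)) : bool := `[< tensor_eq s t >].

Fact teqb_refl : reflexive teqb.
Proof. by move=> s; apply/asboolP; exact: teq_refl. Qed.
Fact teqb_sym : symmetric teqb.
Proof.
by move=> s t; apply/asboolP/asboolP; exact: teq_sym.
Qed.
Fact teqb_trans : transitive teqb.
Proof.
move=> t s r /asboolP st /asboolP tr; apply/asboolP.
exact: teq_trans st tr.
Qed.

Canonical teqb_equiv := EquivRel teqb teqb_refl teqb_sym teqb_trans.

Definition tensor : Type := {eq_quot teqb_equiv}%qT.
HB.instance Definition _ := Choice.on tensor.
HB.instance Definition _ := EqQuotient.on tensor.

Let tpi (s : seq (V * W)) : tensor := (\pi_tensor s)%qT.

Let tpiP s t : tensor_eq s t <-> tpi s = tpi t.
Proof.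
split=> [st|/eqquotP/asboolP //].
by apply/eqquotP; apply/asboolP.
Qed.

Let tpi_repr (x : tensor) : tpi (repr x) = x.
Proof. exact: reprK. Qed.

Let repr_tpi s : tensor_eq (repr (tpi s)) s.
Proof. by apply/tpiP; rewrite tpi_repr. Qed.

Let addt (x y : tensor) : tensor := tpi (repr x ++ repr y).
Let zerot : tensor := tpi [::].
Let scalet (c : F) (x : tensor) : tensor := tpi (fscale c (repr x)).
Let oppt (x : tensor) : tensor := scalet (- 1) x.

Let addtE s t : addt (tpi s) (tpi t) = tpi (s ++ t).
Proof. by apply/tpiP; apply: teq_cat; exact: repr_tpi. Qed.
Let scaletE c s : scalet c (tpi s) = tpi (fscale c s).
Proof. by apply/tpiP; apply: teq_scale; exact: repr_tpi. Qed.

Let tpi_ind (P : tensor -> Prop) : (forall s, P (tpi s)) -> forall x, P x.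
Proof. by move=> Ps x; rewrite -[x]tpi_repr. Qed.

Let teq_shuffle a b c d :
  tensor_eq ((a ++ b) ++ (c ++ d)) ((a ++ c) ++ (b ++ d)).
Proof.
rewrite -!catA; apply: teq_cat; first exact: teq_refl.
by rewrite !catA; apply: teq_cat; [exact: teq_catC|exact: teq_refl].
Qed.

Let fscaleDl a b s : tensor_eq (fscale (a + b) s) (fscale a s ++ fscale b s).
Proof.
elim: s => [|[v w] s IHs] /=; first exact: teq_refl.
apply: (teq_trans (t := [:: (a *: v, w); (b *: v, w)] ++
                        (fscale a s ++ fscale b s))).
  by rewrite -cat1s; apply: teq_cat => //; rewrite scalerDl; exact: teq_Dl.
exact: (teq_shuffle [:: _] [:: _]).
Qed.

Fact tensor_addA : associative addt.
Proof.
by elim/tpi_ind => a; elim/tpi_ind => b; elim/tpi_ind => c; rewrite !addtE catA.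
Qed.
Fact tensor_addC : commutative addt.
Proof.
elim/tpi_ind => a; elim/tpi_ind => b; rewrite !addtE.
by apply/tpiP; exact: teq_catC.
Qed.
Fact tensor_add0 : left_id zerot addt.
Proof. by elim/tpi_ind => a; rewrite addtE. Qed.

Let fscale1 s : fscale 1 s = s.
Proof. by elim: s => //= -[v w] s ->; rewrite scale1r. Qed.

Let fscale0 s : tensor_eq (fscale 0 s) [::].
Proof.
elim: s => [|[v w] s IHs] /=; first exact: teq_refl.
rewrite -cat1s -[in X in tensor_eq _ X](cat0s [::]); apply: teq_cat => //.
by rewrite scale0r; exact: teq_0l.
Qed.

Fact tensor_addN : left_inverse zerot oppt addt.
Proof.
elim/tpi_ind => a; rewrite /oppt scaletE addtE; apply/tpiP.
rewrite -[X in _ ++ X]fscale1; apply: teq_trans (fscale0 a).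
by apply: teq_sym; have := fscaleDl (- 1) 1 a; rewrite addNr.
Qed.

HB.instance Definition _ := GRing.isZmodule.Build tensor
  tensor_addA tensor_addC tensor_add0 tensor_addN.

Fact tensor_scaleA a b x : scalet a (scalet b x) = scalet (a * b) x.
Proof.
elim/tpi_ind: x => s; rewrite !scaletE /fscale -map_comp; congr tpi.
by apply: eq_map => -[v w] /=; rewrite scalerA.
Qed.
Fact tensor_scale1 : left_id 1 scalet.
Proof. by elim/tpi_ind => s; rewrite scaletE fscale1. Qed.
Fact tensor_scaleDr : right_distributive scalet +%R.
Proof.
move=> c; elim/tpi_ind => s; elim/tpi_ind => t.
by rewrite [_ + _]addtE !scaletE [RHS]addtE /fscale map_cat.
Qed.
Fact tensor_scaleDl x : {morph scalet^~ x : a b / a + b}.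
Proof.
elim/tpi_ind: x => s a b; rewrite !scaletE [RHS]addtE.
by apply/tpiP; exact: fscaleDl.
Qed.

HB.instance Definition _ := GRing.Zmodule_isLmodule.Build F tensor
  tensor_scaleA tensor_scale1 tensor_scaleDr tensor_scaleDl.

Definition tens (v : V) (w : W) : tensor := tpi [:: (v, w)].

Lemma tensDl v v' w : tens (v + v') w = tens v w + tens v' w.
Proof. by rewrite [RHS]addtE; apply/tpiP; exact: teq_Dl. Qed.
Lemma tensDr v w w' : tens v (w + w') = tens v w + tens v w'.
Proof. by rewrite [RHS]addtE; apply/tpiP; exact: teq_Dr. Qed.
Lemma tensZl c v w : tens (c *: v) w = c *: tens v w.
Proof. by rewrite [RHS]scaletE. Qed.
Lemma tensZr c v w : tens v (c *: w) = c *: tens v w.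
Proof. by rewrite -tensZl; apply/esym/tpiP; exact: teq_Z. Qed.
Lemma tens_bal v s w : tens (ra v s) w = tens v (la s w).
Proof. by apply/tpiP; exact: teq_bal. Qed.
Lemma tens0l w : tens 0 w = 0.
Proof. by rewrite -(scale0r 0) tensZl scale0r. Qed.
Lemma tens0r v : tens v 0 = 0.
Proof. by rewrite -(scale0r 0) tensZr scale0r. Qed.

Lemma tensor_ind (P : tensor -> Prop) :
    P 0 -> (forall v w, P (tens v w)) ->
    (forall x y, P x -> P y -> P (x + y)) -> forall x, P x.
Proof.
move=> P0 Pt PD; elim/tpi_ind; elim=> [|[v w] s IHs]; first exact: P0.
have -> : tpi ((v, w) :: s) = tens v w + tpi s by rewrite [RHS]addtE.
exact: PD.
Qed.

(* The linear map sending v (x) w to f v w; meaningful when f is balanced.    *)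
Definition tlift (X : zmodType) (f : V -> W -> X) (x : tensor) : X :=
  \sum_(p <- repr x) f p.1 p.2.

Definition balanced (X : lmodType F) (f : V -> W -> X) : Prop :=
  [/\ forall w, linear (f^~ w), forall v, linear (f v) &
      forall v s w, f (ra v s) w = f v (la s w)].

Section Lift.
Variables (X : lmodType F) (f : V -> W -> X).
Hypothesis fbal : balanced f.

Let fDl v v' w : f (v + v') w = f v w + f v' w.
Proof. by have [/(_ w 1 v v')] := fbal; rewrite !scale1r. Qed.
Let fDr v w w' : f v (w + w') = f v w + f v w'.
Proof. by have [_ /(_ v 1 w w')] := fbal; rewrite !scale1r. Qed.
Let f0l w : f 0 w = 0.
Proof. by apply: (addrI (f 0 w)); rewrite -fDl !addr0. Qed.
Let f0r v : f v 0 = 0.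
Proof. by apply: (addrI (f v 0)); rewrite -fDr !addr0. Qed.
Let fZl c v w : f (c *: v) w = c *: f v w.
Proof. by have [/(_ w c v 0)] := fbal; rewrite f0l !addr0. Qed.
Let fZr c v w : f v (c *: w) = c *: f v w.
Proof. by have [_ /(_ v c w 0)] := fbal; rewrite f0r !addr0. Qed.

Let fsum (s : seq (V * W)) := \sum_(p <- s) f p.1 p.2.

Let fsum_scale c s : fsum (fscale c s) = c *: fsum s.
Proof.
rewrite /fsum /fscale big_map scaler_sumr.
by apply: eq_bigr => p _; rewrite /= fZl.
Qed.

Let fsum_eq s t : tensor_eq s t -> fsum s = fsum t.
Proof.
elim=> {s t}.
- by [].
- by [].
- by move=> s t r _ -> _ ->.
- by move=> s s' t t' _ IHs _ IHt; rewrite /fsum !big_cat; congr (_ + _).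
- by move=> c s t _ IH; rewrite !fsum_scale IH.
- by move=> s t; rewrite /fsum !big_cat /= addrC.
- by move=> w; rewrite /fsum big_seq1 big_nil /= f0l.
- by move=> v v' w; rewrite /fsum big_seq1 big_cons big_seq1 /= fDl.
- by move=> v w w'; rewrite /fsum big_seq1 big_cons big_seq1 /= fDr.
- by move=> c v w; rewrite /fsum !big_seq1 /= fZl fZr.
- by move=> v s w; rewrite /fsum !big_seq1 /=; have [_ _ ->] := fbal.
Qed.

Lemma tlift_tens v w : tlift f (tens v w) = f v w.
Proof.
rewrite /tlift; have := fsum_eq (repr_tpi [:: (v, w)]).
by rewrite /fsum big_seq1.
Qed.

Lemma tliftD : {morph tlift f : x y / x + y}.
Proof.
elim/tpi_ind => s; elim/tpi_ind => t; rewrite [_ + _ in LHS]addtE.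
have fE r : tlift f (tpi r) = fsum r by exact/fsum_eq/repr_tpi.
by rewrite !fE /fsum big_cat.
Qed.

Lemma tliftZ c x : tlift f (c *: x) = c *: tlift f x.
Proof.
elim/tpi_ind: x => s; rewrite [_ *: _ in LHS]scaletE.
have fE r : tlift f (tpi r) = fsum r by exact/fsum_eq/repr_tpi.
by rewrite !fE fsum_scale.
Qed.

Lemma tlift_linear : linear (tlift f).
Proof. by move=> c x y; rewrite tliftD tliftZ. Qed.

Lemma tlift0 : tlift f 0 = 0.
Proof. by rewrite -(scale0r 0) tliftZ scale0r. Qed.

End Lift.

End Tensor.

Arguments tens {F S V W ra la} v w.

(* A-B-bimodule structures on an F-space V; F acts centrally, since both      *)
(* actions are F-bilinear for the same scalar multiplication on V.            *)
Record bimod_on (F : fieldType) (A B : algType F) (V : lmodType F) := BimodOn {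
  lact : A -> V -> V;
  ract : V -> B -> V;
  lact_linearl : forall v, linear (lact^~ v);
  lact_linearr : forall a, linear (lact a);
  lactM : forall a b v, lact (a * b) v = lact a (lact b v);
  lact1 : forall v, lact 1 v = v;
  ract_linearl : forall b, linear (ract^~ b);
  ract_linearr : forall v, linear (ract v);
  ractM : forall v a b, ract v (a * b) = ract (ract v a) b;
  ract1 : forall v, ract v 1 = v;
  lractA : forall a v b, ract (lact a v) b = lact a (ract v b)
}.

Record bimod (F : fieldType) (A B : algType F) := Bimod {
  bimod_sort :> lmodType F;
  bimod_struct :> bimod_on A B bimod_sort
}.

Section RegBimod.
Variables (F : fieldType) (A : algType F).

Fact reg_linearl (v : A) : linear (fun a : A => a * v).
Proof. by move=> c a b; rewrite mulrDl scalerAl. Qed.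
Fact reg_linearr (a : A) : linear (fun v : A => a * v).
Proof. by move=> c v w; rewrite mulrDr scalerAr. Qed.

Definition reg_bimod_on : bimod_on A A A :=
  @BimodOn F A A A (fun a v => a * v) (fun v b => v * b)
    reg_linearl reg_linearr (fun a b v => esym (mulrA a b v)) (@mul1r A)
    reg_linearl reg_linearr (@mulrA A) (@mulr1 A)
    (fun a v b => esym (mulrA a v b)).

Definition reg_bimod : bimod A A := Bimod reg_bimod_on.
End RegBimod.

Section TensorBimod.
Variables (F : fieldType) (A B C : algType F) (V : bimod A B) (W : bimod B C).

Definition tensor_over : lmodType F := tensor (ract V) (lact W).

Definition tensor_lact (a : A) : tensor_over -> tensor_over :=
  tlift (fun v w => tens (lact V a v) w).
Definition tensor_ract (x : tensor_over) (c : C) : tensor_over :=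
  tlift (fun v w => tens v (ract W w c)) x.

Fact tensor_lact_bal a :
  balanced (ract V) (lact W)
    (fun v w => tens (lact V a v) w : tensor_over).
Proof.
split=> [w|v|v s w]; first by move=> c x y; rewrite lact_linearr tensDl tensZl.
  by move=> c x y; rewrite tensDr tensZr.
by rewrite -lractA tens_bal.
Qed.
Fact tensor_ract_bal c :
  balanced (ract V) (lact W)
    (fun v w => tens v (ract W w c) : tensor_over).
Proof.
split=> [w|v|v s w]; first by move=> k x y; rewrite tensDl tensZl.
  by move=> k x y; rewrite ract_linearl tensDr tensZr.
by rewrite lractA tens_bal.
Qed.

Lemma tensor_lactE a v w :
  tensor_lact a (tens v w) = tens (lact V a v) w.
Proof. exact: tlift_tens (tensor_lact_bal a) v w. Qed.
Lemma tensor_ractE v w c :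
  tensor_ract (tens v w) c = tens v (ract W w c).
Proof. exact: tlift_tens (tensor_ract_bal c) v w. Qed.

Fact tensor_lact_linearr a : linear (tensor_lact a).
Proof. exact: tlift_linear (tensor_lact_bal a). Qed.
Fact tensor_ract_linearl c : linear (tensor_ract^~ c).
Proof. exact: tlift_linear (tensor_ract_bal c). Qed.

Let lactD a x y : tensor_lact a (x + y) = tensor_lact a x + tensor_lact a y.
Proof. exact: tliftD (tensor_lact_bal a) x y. Qed.
Let lact_0 a : tensor_lact a 0 = 0.
Proof. exact: tlift0 (tensor_lact_bal a). Qed.
Let ractD c x y : tensor_ract (x + y) c = tensor_ract x c + tensor_ract y c.
Proof. exact: tliftD (tensor_ract_bal c) x y. Qed.
Let ract_0 c : tensor_ract 0 c = 0.
Proof. exact: tlift0 (tensor_ract_bal c). Qed.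

Fact tensor_lact_linearl x : linear (tensor_lact^~ x).
Proof.
move=> k a b; elim/tensor_ind: x => [|v w|x y IHx IHy].
- by rewrite !lact_0 scaler0 addr0.
- by rewrite !tensor_lactE lact_linearl tensDl tensZl.
- by rewrite !lactD IHx IHy scalerDr addrACA.
Qed.
Fact tensor_ract_linearr x : linear (tensor_ract x).
Proof.
move=> k a b; elim/tensor_ind: x => [|v w|x y IHx IHy].
- by rewrite !ract_0 scaler0 addr0.
- by rewrite !tensor_ractE ract_linearr tensDr tensZr.
- by rewrite !ractD IHx IHy scalerDr addrACA.
Qed.
Fact tensor_lactM a b x : tensor_lact (a * b) x = tensor_lact a (tensor_lact b x).
Proof.
elim/tensor_ind: x => [|v w|x y IHx IHy]; first by rewrite !lact_0.
  by rewrite !tensor_lactE lactM.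
by rewrite !lactD IHx IHy.
Qed.
Fact tensor_ractM x a b : tensor_ract x (a * b) = tensor_ract (tensor_ract x a) b.
Proof.
elim/tensor_ind: x => [|v w|x y IHx IHy]; first by rewrite !ract_0.
  by rewrite !tensor_ractE ractM.
by rewrite !ractD IHx IHy.
Qed.
Fact tensor_lact1 x : tensor_lact 1 x = x.
Proof.
elim/tensor_ind: x => [|v w|x y IHx IHy]; first by rewrite !lact_0.
  by rewrite !tensor_lactE lact1.
by rewrite !lactD IHx IHy.
Qed.
Fact tensor_ract1 x : tensor_ract x 1 = x.
Proof.
elim/tensor_ind: x => [|v w|x y IHx IHy]; first by rewrite !ract_0.
  by rewrite !tensor_ractE ract1.
by rewrite !ractD IHx IHy.
Qed.
Fact tensor_lractA a x c :
  tensor_ract (tensor_lact a x) c = tensor_lact a (tensor_ract x c).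
Proof.
elim/tensor_ind: x => [|v w|x y IHx IHy]; first by rewrite !(lact_0, ract_0).
  by rewrite !(tensor_lactE, tensor_ractE).
by rewrite !(lactD, ractD) IHx IHy.
Qed.

Definition tensor_bimod : bimod A C :=
  Bimod (BimodOn tensor_lact_linearl tensor_lact_linearr tensor_lactM
    tensor_lact1 tensor_ract_linearl tensor_ract_linearr tensor_ractM
    tensor_ract1 tensor_lractA).

End TensorBimod.

Section CompleteTensorAlgebra.
Variables (F : fieldType) (E : algType F) (M : bimod E E).

Fixpoint tpow (i : nat) : bimod E E :=
  if i is j.+1 then tensor_bimod M (tpow j) else reg_bimod E.

Definition ctalg : Type := dprod (fun i => tpow i : lmodType F).
HB.instance Definition _ := GRing.Lmodule.on ctalg.

(* m . g for m in M: its degree k + 1 component is m (x) g(k).                *)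
Definition mshift (m : M) (g : ctalg) : ctalg :=
  fun k => if k is l.+1 return tpow k then tens m (g l) else 0.

(* x . g for x homogeneous of degree i: (s . g)(k) = s g(k) for s in E, and   *)
(* (m (x) y) . g = m . (y . g); so (x . g)(k) = x g(k - i), and 0 if k < i.   *)
Fixpoint tmul (i : nat) : tpow i -> ctalg -> ctalg :=
  if i is j.+1 return tpow i -> ctalg -> ctalg then
    fun x g => tlift (fun m y => mshift m (tmul y g)) x
  else fun s g k => lact (tpow k) s (g k).
Arguments tmul : clear implicits.

(* Since f(s) . g is g(k - s) multiplied by f(s) in degree k, this is         *)
(* (fg)(k) = \sum_(s + t = k) f(s) g(t).                                      *)
Definition cmul (f g : ctalg) : ctalg :=
  fun k => \sum_(s < k.+1) tmul s (f s) g k.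

Definition incl0 (s : E) : ctalg :=
  fun k => if k is 0 return tpow k then s else 0.

Definition incl1 (m : M) : ctalg := mshift m (incl0 1).

Lemma mshift_linearl g : linear (mshift^~ g).
Proof.
move=> c m m'; apply: dprodP => -[|k].
  by rewrite dprodDE dprodZE /= scaler0 addr0.
by rewrite dprodDE dprodZE /= tensDl tensZl.
Qed.

Lemma mshift_linearr m : linear (mshift m).
Proof.
move=> c f g; apply: dprodP => -[|k].
  by rewrite dprodDE dprodZE /= scaler0 addr0.
by rewrite [RHS]dprodDE dprodZE /= [X in tens _ X]dprodDE dprodZE tensDr tensZr.
Qed.

Fact tmul_lact_bal i (tmul_i : tpow i -> ctalg -> ctalg) g :
    (forall g, linear (tmul_i^~ g)) ->
    (forall s y g, tmul_i (lact (tpow i) s y) g = tmul 0 s (tmul_i y g)) ->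
  balanced (ract M) (lact (tpow i)) (fun m y => mshift m (tmul_i y g)).
Proof.
move=> tl ts; split=> [y|m|m s y]; first exact: mshift_linearl.
  by move=> c y y'; rewrite tl mshift_linearr.
by apply: dprodP => -[|k] //=; rewrite tens_bal ts.
Qed.

Lemma tmul0_linearl g : linear ((tmul 0)^~ g).
Proof. by move=> c s t; apply: dprodP => k; rewrite /= lact_linearl. Qed.

Lemma tmul_spec i :
  (forall g, linear ((tmul i)^~ g)) /\
  (forall s y g, tmul i (lact (tpow i) s y) g = tmul 0 s (tmul i y g)).
Proof.
elim: i => [|i [IHl IHs]].
  split=> [|s t g]; first exact: tmul0_linearl.
  by apply: dprodP => k; rewrite /= lactM.
have bal g := tmul_lact_bal g IHl IHs.
have l0 s : linear (tmul 0 s).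
  by move=> c f g; apply: dprodP => k; rewrite /= lact_linearr.
have tD g x y : tmul i.+1 (x + y) g = tmul i.+1 x g + tmul i.+1 y g.
  exact: tliftD (bal g) x y.
split=> [g|s y g]; first exact: tlift_linear (bal g).
elim/tensor_ind: y => [|m y|x y IHx IHy].
- have -> : lact (tpow i.+1) s 0 = 0.
    by have := lact_linearr (tpow i.+1) s (-1) 0 0; rewrite !scaleN1r !addNr.
  have -> : tmul i.+1 0 g = 0 by exact: tlift0 (bal g).
  by have := l0 s (-1) 0 0; rewrite !scaleN1r !addNr.
- rewrite [lact _ _ _]tensor_lactE /= !(tlift_tens (bal g)).
  apply: dprodP => -[|k] /=; last by rewrite tensor_lactE.
  by rewrite mulr0.
- have -> : lact (tpow i.+1) s (x + y) =
            lact (tpow i.+1) s x + lact (tpow i.+1) s y.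
    by have := lact_linearr (tpow i.+1) s 1 x y; rewrite !scale1r.
  by rewrite !tD IHx IHy; have := l0 s 1 (tmul i.+1 x g) (tmul i.+1 y g);
     rewrite !scale1r.
Qed.

Lemma tmul_linearl i g : linear ((tmul i)^~ g).
Proof. exact: (tmul_spec i).1. Qed.

Lemma tmul_lact i s y g :
  tmul i (lact (tpow i) s y) g = tmul 0 s (tmul i y g).
Proof. exact: (tmul_spec i).2. Qed.

Lemma tmul_bal i g :
  balanced (ract M) (lact (tpow i)) (fun m y => mshift m (tmul i y g)).
Proof. exact: tmul_lact_bal (@tmul_linearl i) (@tmul_lact i). Qed.

Lemma tmul_tens i m y g :
  tmul i.+1 (tens m y) g = mshift m (tmul i y g).
Proof. exact: tlift_tens (tmul_bal i g) m y. Qed.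

Lemma tmulDl i x y g : tmul i (x + y) g = tmul i x g + tmul i y g.
Proof. by have := tmul_linearl g 1 x y; rewrite !scale1r. Qed.
Lemma tmul0l i g : tmul i 0 g = 0.
Proof. by apply: (addrI (tmul i 0 g)); rewrite -tmulDl !addr0. Qed.

Lemma tpow_ind (P : forall i, tpow i -> Prop) :
    (forall i, P i 0) -> (forall i x y, P i x -> P i y -> P i (x + y)) ->
    (forall s, P 0 s) ->
    (forall i m (y : tpow i), P i y -> P i.+1 (tens m y)) ->
  forall i x, P i x.
Proof.
move=> P0 PD Ps PM; elim=> [|i IHi] x; first exact: Ps.
by elim/tensor_ind: x => [|m y|x y Px Py]; [exact: P0|exact: PM|exact: PD].
Qed.

Lemma tmul_linearr i x : linear (tmul i x).
Proof.
move=> c f g; elim/tpow_ind: i / x => [i|i x y IHx IHy|s|i m y IHy].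
- by rewrite !tmul0l scaler0 addr0.
- by rewrite !tmulDl IHx IHy scalerDr addrACA.
- by apply: dprodP => k; rewrite /= lact_linearr.
- by rewrite !tmul_tens IHy mshift_linearr.
Qed.

Lemma tmul_lt i x g k : (k < i)%N -> tmul i x g k = 0.
Proof.
elim/tpow_ind: i / x k => [i|i x y IHx IHy|s|i m y IHy] k ki //.
- by rewrite tmul0l.
- by rewrite tmulDl dprodDE IHx // IHy // addr0.
- by rewrite tmul_tens; case: k ki => //= k ki; rewrite IHy // tens0r.
Qed.

Lemma lact0r i s : lact (tpow i) s 0 = 0.
Proof. by have := lact_linearr (tpow i) s (-1) 0 0; rewrite !scaleN1r !addNr. Qed.

Lemma tmul_eq0 i x g k : (i <= k)%N -> g (k - i)%N = 0 -> tmul i x g k = 0.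
Proof.
elim/tpow_ind: i / x k => [i|i x y IHx IHy|s|i m y IHy] k ik gk //.
- by rewrite tmul0l.
- by rewrite tmulDl dprodDE IHx // IHy // addr0.
- by rewrite subn0 in gk; rewrite /= gk lact0r.
- by rewrite tmul_tens; case: k ik gk => //= k ik gk; rewrite IHy // tens0r.
Qed.

Fact cmul_linearl g : linear (cmul^~ g).
Proof.
move=> c f f'; apply: dprodP => k; rewrite dprodDE dprodZE /cmul.
rewrite scaler_sumr -big_split; apply: eq_bigr => i _.
by rewrite /= dprodDE dprodZE tmul_linearl.
Qed.

Fact cmul_linearr f : linear (cmul f).
Proof.
move=> c g g'; apply: dprodP => k; rewrite dprodDE dprodZE /cmul.
rewrite scaler_sumr -big_split; apply: eq_bigr => i _.
by rewrite /= tmul_linearr.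
Qed.

Let cmulDl f f' g : cmul (f + f') g = cmul f g + cmul f' g.
Proof. by have := cmul_linearl g 1 f f'; rewrite !scale1r. Qed.
Let cmulDr f g g' : cmul f (g + g') = cmul f g + cmul f g'.
Proof. by have := cmul_linearr f 1 g g'; rewrite !scale1r. Qed.
Let cmul0 g : cmul 0 g = 0.
Proof. by apply: (addrI (cmul 0 g)); rewrite -cmulDl !addr0. Qed.

Lemma cmul_tmul i x g h : cmul (tmul i x g) h = tmul i x (cmul g h).
Proof.
elim/tpow_ind: i / x => [i|i x y IHx IHy|s|i m y IHy].
- by rewrite !tmul0l cmul0.
- by rewrite !tmulDl cmulDl IHx IHy.
- apply: dprodP => k; rewrite /cmul /=.
  rewrite (big_morph (lact (tpow k) s) (id1 := 0) (op1 := +%R)).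
  + by apply: eq_bigr => j _; rewrite tmul_lact.
  + by move=> x y; have := lact_linearr (tpow k) s 1 x y; rewrite !scale1r.
  + exact: lact0r.
- rewrite !tmul_tens -IHy; apply: dprodP => -[|k] /=.
    by rewrite /cmul big_ord1 tmul0l.
  rewrite /cmul big_ord_recl tmul0l add0r.
  rewrite (big_morph (fun z => tens m z : tpow k.+1) (id1 := 0) (op1 := +%R)).
  + apply: eq_bigr => j _.
    exact: (congr1 (fun z : ctalg => z k.+1) (tmul_tens _ _ _)).
  + by move=> a b; rewrite tensDr.
  + exact: tens0r.
Qed.

Let tmul_suml i (J : Type) (r : seq J) (P : pred J) (f : J -> tpow i) g :
  tmul i (\sum_(j <- r | P j) f j) g = \sum_(j <- r | P j) tmul i (f j) g.
Proof.
by apply: (big_morph ((tmul i)^~ g)) => [x y|]; [exact: tmulDl|exact: tmul0l].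
Qed.

Fact cmulA : associative cmul.
Proof.
move=> f g h; apply: dprodP => k; apply/esym.
rewrite /cmul; under eq_bigr => j _ do rewrite tmul_suml dprod_sumE.
under [RHS]eq_bigr => i _ do rewrite -[tmul _ _ _ _]/(tmul i (f i) (cmul g h) k).
under [RHS]eq_bigr => i _ do rewrite -cmul_tmul /cmul.
rewrite [RHS]exchange_big /=; apply: eq_bigr => j _.
rewrite (big_ord_widen k.+1 (fun i => tmul j (tmul i (f i) g j) h k)) //.
rewrite [RHS](bigID (fun i : 'I_k.+1 => (i < j.+1)%N)) /=.
rewrite [X in _ + X]big1 ?addr0 // => i; rewrite -leqNgt => ji.
by rewrite [tmul i _ _ _]tmul_lt // tmul0l.
Qed.

Fact cmul1l : left_id (incl0 1) cmul.
Proof.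
move=> f; apply: dprodP => k; rewrite /cmul big_ord_recl big1 => [|j _].
  by rewrite addr0 /= lact1.
exact: (congr1 (fun z : ctalg => z k) (tmul0l j.+1 f)).
Qed.

Fact tmul_incl0 i x s k :
  tmul i x (incl0 s) k = if i =P k is ReflectT e
    then ract (tpow k) (ecast z (tpow z) e x) s else 0.
Proof.
case: eqP => [e|/eqP ne].
  case: k / e => /=.
  elim/tpow_ind: i / x => [i|i x y IHx IHy|t|i m y IHy].
  - rewrite tmul0l; apply/esym.
    by have := ract_linearl (tpow i) s (-1) 0 0; rewrite !scaleN1r !addNr.
  - rewrite tmulDl dprodDE IHx IHy.
    by have := ract_linearl (tpow i) s 1 x y; rewrite !scale1r.
  - by [].
  - by rewrite tmul_tens /= IHy tensor_ractE.
have [ki|ik|ik] := ltngtP k i; first exact: tmul_lt.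
  apply: tmul_eq0; first exact: ltnW.
  by move: ik; rewrite -subn_gt0; case: (k - i)%N.
by rewrite ik eqxx in ne.
Qed.

Fact cmul1r : right_id (incl0 1) cmul.
Proof.
move=> f; apply: dprodP => k; rewrite /cmul big_ord_recr /=.
rewrite big1 => [|j _].
  rewrite tmul_incl0; case: eqP => // e.
  by rewrite add0r ract1 eq_axiomK.
rewrite tmul_incl0; case: eqP => // e.
by have := ltn_ord j; rewrite [nat_of_ord j in X in X -> _]e ltnn.
Qed.

Fact cmul_1neq0 : incl0 1 != 0.
Proof.
apply/eqP => /(congr1 (fun f : ctalg => f 0%N)) /eqP.
by rewrite (negPf (oner_neq0 E)).
Qed.

HB.instance Definition _ := GRing.Zmodule_isNzRing.Build ctalg
  cmulA cmul1l cmul1r (fun f g h => cmulDl f g h) (fun f g h => cmulDr f g h)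
  cmul_1neq0.

Fact cmul_scaleAl (c : F) (f g : ctalg) : c *: (f * g) = (c *: f) * g.
Proof.
have : cmul (c *: f + 0) g = c *: cmul f g + cmul 0 g by exact: cmul_linearl.
by rewrite cmul0 !addr0 => /esym.
Qed.
HB.instance Definition _ :=
  GRing.Lmodule_isLalgebra.Build F ctalg cmul_scaleAl.
Fact cmul_scaleAr (c : F) (f g : ctalg) : c *: (f * g) = f * (c *: g).
Proof.
have : cmul f (c *: g + 0) = c *: cmul f g + cmul f 0 by exact: cmul_linearr.
have -> : cmul f 0 = 0 by exact: mulr0.
by rewrite !addr0 => /esym.
Qed.
HB.instance Definition _ :=
  GRing.Lalgebra_isAlgebra.Build F ctalg cmul_scaleAr.

Lemma ctalgME (f g : ctalg) k : (f * g) k = \sum_(s < k.+1) tmul s (f s) g k.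
Proof. by []. Qed.

Definition fin_supp : {pred ctalg} :=
  fun f => `[< exists N, forall i, (N <= i)%N -> f i = 0 >].

Fact fin_supp_subalg : GRing.subalg_closed fin_supp.
Proof.
split=> [|c f g|f g].
- by apply/asboolP; exists 1%N => -[].
- move=> /asboolP[a fa] /asboolP[b gb]; apply/asboolP; exists (maxn a b) => i.
  rewrite geq_max => /andP[ai bi].
  by rewrite dprodDE dprodZE fa // gb // scaler0 addr0.
- move=> /asboolP[a fa] /asboolP[b gb]; apply/asboolP; exists (a + b)%N => i abi.
  rewrite ctalgME big1 // => j _; have [aj|ja] := leqP a j.
    by rewrite fa // tmul0l.
  apply: tmul_eq0; first by rewrite -ltnS.
  by apply: gb; rewrite leq_subRL -1?ltnS //; apply: leq_trans abi; rewrite leq_add2r ltnW.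
Qed.
HB.instance Definition _ :=
  GRing.isSubalgClosed.Build F ctalg fin_supp fin_supp_subalg.

Record talg : Type := Talg {talg_val :> ctalg; _ : talg_val \in fin_supp}.
HB.instance Definition _ := [isSub for talg_val].
HB.instance Definition _ := [Choice of talg by <:].
HB.instance Definition _ := [SubChoice_isSubAlgebra of talg by <:].

Fact homog_fin_supp (f : ctalg) (i : nat) :
  ((fun k => if k == i then f k else 0) : ctalg) \in fin_supp.
Proof.
apply/asboolP; exists i.+1 => k; case: eqP => // ->; by rewrite ltnn.
Qed.

(* The element of T_E(M) whose only nonzero component is f(i), in degree i.   *)
Definition homog (f : ctalg) (i : nat) : talg := Talg (homog_fin_supp f i).

Fact incl0_fin_supp s : incl0 s \in fin_supp.
Proof. by apply/asboolP; exists 1%N => -[]. Qed.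
Fact incl1_fin_supp m : incl1 m \in fin_supp.
Proof. by apply/asboolP; exists 2 => -[|[|k]] //= _; exact: tens0r. Qed.

Definition tincl0 (s : E) : talg := Talg (incl0_fin_supp s).
Definition tincl1 (m : M) : talg := Talg (incl1_fin_supp m).

Definition deg_ge (k : nat) : set ctalg :=
  [set f | forall j, (j < k)%N -> f j = 0].

(* Closure for the metric d(f, g) = 2 ^ (- nu(f - g)): f - g has all its      *)
(* components of degree < N equal to 0 if and only if d(f, g) <= 2 ^ (- N).   *)
Definition tclosure (B : set ctalg) : set ctalg :=
  [set f | forall N, exists2 g, B g & deg_ge N (f - g)].

Definition lspan (B : set ctalg) : set ctalg :=
  [set f | exists s : seq (F * ctalg),
     (forall p, p \in s -> B p.2) /\ f = \sum_(p <- s) p.1 *: p.2].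

Definition ideal_gen (B : set ctalg) : set ctalg :=
  lspan [set f | exists x g y, B g /\ f = x * g * y].

Definition commutators : set ctalg :=
  tclosure (lspan [set h | exists f g, h = f * g - g * f]).

Definition cyc_equiv (f g : ctalg) : Prop := commutators (f - g).

Definition closed_sq (B : set ctalg) : set ctalg :=
  tclosure (lspan [set h | exists f g, [/\ B f, B g & h = f * g]]).

(* psi(m_1 ... m_l) = psi(m_1) m_2 ... m_l and psi(s) = 0 for s in E.         *)
Definition psi_ext (psi : M -> E) (f : ctalg) : ctalg :=
  fun l => tlift (fun m y => lact (tpow l) (psi m) y) (f l.+1).

End CompleteTensorAlgebra.

Arguments tmul {F E M} i x g.

Section Cyclic.
Variables (F : fieldType) (n : nat) (E_ : 'I_n.+1 -> falgType F).
Local Notation E := (prodalg E_).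
Local Notation Z := (Ztype E_).
Local Notation e := (idem E_).

Variables (V : vectType F) (M : bimod_on E E V) (M0 : {vspace V}).
Local Notation BM := (Bimod M).
Local Notation FM := (ctalg BM).
Local Notation T := (talg BM).

Definition sub_ZZbimod : Prop :=
  forall z m, Zsub z -> m \in M0 -> lact M z m \in M0 /\ ract M m z \in M0.

(* When M0 is a subbimodule, the projection vsproj M0 only changes the type.  *)
Definition M0_lact (z : Z) (m : subvs_of M0) : subvs_of M0 :=
  vsproj M0 (lact M (sval z) (vsval m)).
Definition M0_ract (m : subvs_of M0) (z : Z) : subvs_of M0 :=
  vsproj M0 (ract M (vsval m) (sval z)).

Definition EM0 : lmodType F := tensor (fun (s : E) (z : Z) => s * sval z) M0_lact.
Definition EM0_ract (x : EM0) (z : Z) : EM0 :=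
  tlift (fun s m => tens s (M0_ract m z)) x.
Definition EM0E : lmodType F := tensor EM0_ract (fun (z : Z) (s : E) => sval z * s).

Definition mult_map : EM0E -> V :=
  tlift (fun x t => tlift (fun s m => ract M (lact M s (vsval m)) t) x).

(* mult_map is a morphism of E-E-bimodules, hence an isomorphism as soon as   *)
(* it is bijective.                                                           *)
Definition Zfree : Prop := sub_ZZbimod /\ bijective mult_map.

Definition potential (P : FM) : Prop :=
  P = \sum_i incl0 BM (e i) * P * incl0 BM (e i).

Definition TZT : lmodType F :=
  tensor (fun (x : T) (z : Z) => x * tincl0 BM (sval z))
         (fun (z : Z) (y : T) => tincl0 BM (sval z) * y).

Definition TZT_lact (t : T) (w : TZT) : TZT := tlift (fun x y => tens (t * x) y) w.
Definition TZT_ract (w : TZT) (t : T) : TZT := tlift (fun x y => tens x (y * t)) w.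

Definition is_Delta (D : T -> TZT) : Prop :=
  [/\ linear D,
      forall x y, D (x * y) = TZT_ract (D x) y + TZT_lact x (D y),
      forall s : E, D (tincl0 BM s) = tens 1 (tincl0 BM s) - tens (tincl0 BM s) 1 &
      forall m : V, m \in M0 -> D (tincl1 (m : BM)) = tens 1 (tincl1 (m : BM))].

Definition u_map (w : TZT) : T :=
  tlift (fun x y => \sum_i tincl0 BM (e i) * y * x * tincl0 BM (e i)) w.

Definition hT (D : T -> TZT) (f g : T) : T := u_map (TZT_ract (D f) g).

Definition hF (D : T -> TZT) (f g : FM) : FM :=
  fun l => \sum_(i < l.+1) (hT D (homog f i) (homog g (l - i)) : FM) l.

Definition delta (D : T -> TZT) (f : FM) : FM := hF D f 1.

Definition delta_psi (D : T -> TZT) (psi : V -> E) (f : FM) : FM :=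
  psi_ext (psi : BM -> E) (delta D f).

Definition is_Fbasis (W : lmodType F) (U : set W) (s : seq W) : Prop :=
  (forall w, w \in s -> U w) /\
  (forall w, U w ->
     exists! c : {ffun 'I_(size s) -> F}, w = \sum_(k < size s) c k *: s`_k).

Definition is_M0_basis (A : 'I_n.+1 -> 'I_n.+1 -> seq V) : Prop :=
  forall i j, is_Fbasis
    [set m | exists2 m0, m0 \in M0 & m = ract M (lact M (e i) m0) (e j)] (A i j).

Definition is_E_basis (L : 'I_n.+1 -> seq E) : Prop :=
  forall i, is_Fbasis [set x : E | exists y, x = e i * y] (L i).

Definition right_Elinear (psi : V -> E) : Prop :=
  (forall m m', psi (m + m') = psi m + psi m') /\
  (forall m s, psi (ract M m s) = psi m * s).

(* star s a is the map (sa)^*.                                                *)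
Definition is_dual (A : 'I_n.+1 -> 'I_n.+1 -> seq V) (L : 'I_n.+1 -> seq E)
    (star : E -> V -> V -> E) : Prop :=
  forall i j a s, a \in A i j -> s \in L i ->
    [/\ right_Elinear (star s a),
        star s a (lact M s a) = e j &
        forall i' j' a' s', a' \in A i' j' -> s' \in L i' ->
          (s', a') <> (s, a) -> star s a (lact M s' a') = 0].

Section RP.
Variables (D : T -> TZT) (A : 'I_n.+1 -> 'I_n.+1 -> seq V).
Variables (L : 'I_n.+1 -> seq E) (star : E -> V -> V -> E).

(* X_{a^*}(P) for a with tau(a) = i.                                          *)
Definition Xstar (i : 'I_n.+1) (a : V) (P : FM) : FM :=
  \sum_(s <- L i) delta_psi D (star s a) P * incl0 BM s.

Definition Rideal (P : FM) : set FM :=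
  tclosure (ideal_gen [set f | exists i j a, a \in A i j /\ f = Xstar i a P]).

End RP.

End Cyclic.

(* Main.v *)
Require Import Defs.
From HB Require Import structures.
From mathcomp Require Import all_boot all_algebra all_field.
From mathcomp Require Import boolp classical_sets.

Set Implicit Arguments.
Unset Strict Implicit.
Unset Printing Implicit Defensive.

Import GRing.Theory.
Local Open Scope ring_scope.

(** The theorem is a Newton iteration. Write m for the ideal of elements without
    degree zero term, X_a for the cyclic derivative X_{a^*}(P), J for R(P), and J_n
    for the closed span of the x X_a y with x in m^p, y in m^q and p + q >= n, so
    that J_0 = J. As P lies in m^3, each X_a lies in m^2, and J_n in m^(n + 2).

    Since M is free, any family b = (b_a) defines an algebra endomorphism
    phi_b which fixes E and sends each a in A to a + e_i b_a e_j; if the b_a lie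
    in J, then b_a is in m^2, phi_b is invertible (ext_bij), and phi_b(f) - f is
    in J for all f (ext_sub_J). For two families b and b' one telescopes
    phi_b'(P) - phi_b(P) along each word of P and rotates every summand until its
    factor phi_b'(a) - phi_b(a) stands first: up to cyclic equivalence the
    result is the sum of the (b'_a - b_a) Y_a, where Y_a is a cyclic derivative
    of P with b' applied to the letters before a and b to those after a. As
    P lies in m^3, the words of Y_a have at least two letters, hence Y_a - X_a is
    in J_1 and not only in J_0 (twisted_cyclic_derivative, phi_sub_cyc).

    Let G_n be the set of elements cyclically equivalent to some sum of C_a X_a
    with C_a in J_n. If P' - phi_b(P) is in G_n, with coefficients C_a, put
    b' = b + C. Then P' - phi_b'(P) is cyclically equivalent to the sum of the
    C_a (X_a - Y_a), which belongs to J_n J_1, and J_n J_1 is contained in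
    G_(n + 1) (deformation_step). The iteration starts from b = 0, because
    P' - P is in the closed square of J, hence in G_0. The corrections C lie in
    m^(n + 2), so the families converge, and the limit solves the problem.

    The analytic point is that the closure of J_p J_q is contained in G_(p + q):
    an element of the closure is a limit of sums of x X_a y X_b z, and these
    sums may involve cancelling terms of low degree, so that their coefficients
    need not converge. Finite-dimensionality repairs this: a finite-dimensional
    space plus a closed space is closed (tclosure_add_line), so the element
    can be expanded degree by degree (two_X_step), and the resulting
    coefficients do converge (two_X_Gfil). *)

(** * The degree filtration and closures *)

Section Topology.
Variables (F : fieldType) (E : algType F) (M : bimod E E).
Local Notation FM := (ctalg M).
Implicit Types (f g h : FM) (S : set FM).

Lemma deg_ge_0 k : deg_ge k (0 : FM).
Proof. by []. Qed.

Lemma deg_ge0 f : deg_ge 0 f.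
Proof. by []. Qed.

Lemma deg_geP k c f g : deg_ge k f -> deg_ge k g -> deg_ge k (c *: f + g).
Proof. by move=> hf hg j jk; rewrite dprodDE dprodZE hf // hg // scaler0 addr0. Qed.

Lemma deg_geD k f g : deg_ge k f -> deg_ge k g -> deg_ge k (f + g).
Proof. by move=> hf hg; rewrite -[f]scale1r; apply: deg_geP. Qed.

Lemma deg_geN k f : deg_ge k f -> deg_ge k (- f).
Proof. by move=> hf; rewrite -scaleN1r -[_ *: _]addr0; apply: deg_geP. Qed.

Lemma deg_geB k f g : deg_ge k f -> deg_ge k g -> deg_ge k (f - g).
Proof. by move=> hf hg; apply: deg_geD => //; apply: deg_geN. Qed.

Lemma deg_ge_sum k (J : Type) (r : seq J) (Q : pred J) (u : J -> FM) :
  (forall j, Q j -> deg_ge k (u j)) -> deg_ge k (\sum_(j <- r | Q j) u j).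
Proof. by move=> hu; elim/big_ind: _ => //; exact: deg_geD. Qed.

Lemma deg_geW j k f : (j <= k)%N -> deg_ge k f -> deg_ge j f.
Proof. by move=> jk hf i ij; apply: hf; apply: leq_trans jk. Qed.

Lemma deg_ge_eq0 f : (forall k, deg_ge k f) -> f = 0.
Proof. by move=> hf; apply: dprodP => k; apply: (hf k.+1). Qed.

Lemma deg_geM i j f g : deg_ge i f -> deg_ge j g -> deg_ge (i + j) (f * g).
Proof.
move=> hf hg k kij; rewrite ctalgME big1 // => s _.
have [si|is_] := ltnP s i; first by rewrite hf // tmul0l.
apply: tmul_eq0; first by rewrite -ltnS.
apply: hg; rewrite ltn_subLR; last by rewrite -ltnS.
by apply: leq_trans kij _; rewrite leq_add2r.
Qed.

Lemma deg_geMl j f g : deg_ge j g -> deg_ge j (f * g).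
Proof. exact: (@deg_geM 0). Qed.

Lemma deg_geMr i f g : deg_ge i f -> deg_ge i (f * g).
Proof. by move=> hf; rewrite -[i]addn0; apply: deg_geM. Qed.

Definition subspace S := S 0 /\ forall c f g, S f -> S g -> S (c *: f + g).

Section Subspace.
Variables (S : set FM) (subS : subspace S).

Lemma subspace0 : S 0. Proof. by case: subS. Qed.
Lemma subspaceP c f g : S f -> S g -> S (c *: f + g).
Proof. by case: subS => _; apply. Qed.
Lemma subspaceD f g : S f -> S g -> S (f + g).
Proof. by move=> Sf Sg; rewrite -[f]scale1r; apply: subspaceP. Qed.
Lemma subspaceZ c f : S f -> S (c *: f).
Proof.
by move=> Sf; rewrite -[_ *: _]addr0; apply: subspaceP => //; exact: subspace0.
Qed.
Lemma subspaceN f : S f -> S (- f).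
Proof. by rewrite -scaleN1r; apply: subspaceZ. Qed.
Lemma subspaceB f g : S f -> S g -> S (f - g).
Proof. by move=> Sf Sg; apply: subspaceD => //; apply: subspaceN. Qed.
Lemma subspace_sum (J : Type) (r : seq J) (Q : pred J) (u : J -> FM) :
  (forall j, Q j -> S (u j)) -> S (\sum_(j <- r | Q j) u j).
Proof. by move=> hu; elim/big_ind: _ => //; [exact: subspace0|exact: subspaceD]. Qed.
End Subspace.

Lemma lspan_subspace S : subspace (lspan S).
Proof.
split=> [|c f g [s [sS ->]] [t [tS ->]]]; first by exists [::]; rewrite big_nil.
exists ([seq (c * p.1, p.2) | p <- s] ++ t); split=> [p|].
  by rewrite mem_cat => /orP[/mapP[q qs ->]|]; [exact: (sS q)|exact: tS].
rewrite big_cat big_map scaler_sumr /=.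
by congr (_ + _); apply: eq_bigr => p _; rewrite scalerA.
Qed.

Lemma lspan_mem S f : S f -> lspan S f.
Proof.
move=> Sf; exists [:: (1, f)]; split=> [p|]; last by rewrite big_seq1 scale1r.
by rewrite inE => /eqP ->.
Qed.

Lemma lspan_min S U : subspace U -> (forall f, S f -> U f) ->
  forall f, lspan S f -> U f.
Proof.
move=> subU SU _ [s [sS ->]]; rewrite big_seq; apply: subspace_sum => // p ps.
by apply: subspaceZ => //; apply/SU/sS.
Qed.

Lemma lspanS S U : (forall f, S f -> U f) -> forall f, lspan S f -> lspan U f.
Proof.
move=> SU; apply: lspan_min; first exact: lspan_subspace.
by move=> f Sf; apply/lspan_mem/SU.
Qed.

Lemma tclosure_subspace S : subspace S -> subspace (tclosure S).
Proof.
move=> subS; split=> [N|c f g cf cg N].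
  by exists 0; [exact: subspace0|rewrite subr0].
have [f' Sf' ff'] := cf N; have [g' Sg' gg'] := cg N.
exists (c *: f' + g'); first exact: subspaceP.
have -> : c *: f + g - (c *: f' + g') = c *: (f - f') + (g - g').
  by rewrite scalerBr opprD addrACA.
exact: deg_geP.
Qed.

Lemma tclosure_lspan_subspace S : subspace (tclosure (lspan S)).
Proof. exact/tclosure_subspace/lspan_subspace. Qed.
Hint Resolve lspan_subspace tclosure_lspan_subspace : core.

Lemma tclosure_mem S f : S f -> tclosure S f.
Proof. by move=> Sf N; exists f; rewrite ?subrr. Qed.

Lemma tclosure_lspan_mem S f : S f -> tclosure (lspan S) f.
Proof. by move=> Sf; apply/tclosure_mem/lspan_mem. Qed.

Lemma tclosureS S U : (forall f, S f -> U f) ->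
  forall f, tclosure S f -> tclosure U f.
Proof. by move=> SU f cf N; have [g Sg fg] := cf N; exists g; first exact: SU. Qed.

Lemma tclosure_approx S f :
  (forall N, exists2 g, tclosure S g & deg_ge N (f - g)) -> tclosure S f.
Proof.
move=> cf N; have [g cg fg] := cf N; have [h Sh gh] := cg N; exists h => //.
by rewrite -(subrK g f) -addrA; apply: deg_geD.
Qed.

Lemma tclosure_lspan_min S U : (forall f, S f -> tclosure (lspan U) f) ->
  forall f, tclosure (lspan S) f -> tclosure (lspan U) f.
Proof.
move=> SU f cf; apply: tclosure_approx => N; have [g Sg fg] := cf N.
by exists g => //; move: Sg; apply: lspan_min.
Qed.

Lemma tclosure_deg_ge S k : (forall f, S f -> deg_ge k f) ->
  forall f, tclosure (lspan S) f -> deg_ge k f.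
Proof.
move=> Sk f cf; have [g Sg fg] := cf k; rewrite -(subrK g f).
apply: deg_geD => //; move: Sg; apply: lspan_min => //.
by split=> //; exact: deg_geP.
Qed.

(** The sequences [u] used below all satisfy
    [u (n + 1) = u n] in degrees less than [n]; their limit can then be read
    on a diagonal. *)
Definition diag_lim (u : nat -> FM) : FM := fun l => u l.+1 l.

Lemma diag_limP (u : nat -> FM) : (forall n, deg_ge n (u n.+1 - u n)) ->
  forall n, deg_ge n (diag_lim u - u n).
Proof.
move=> hu n l ln; rewrite dprodDE dprodNE /diag_lim.
have -> : u n l = u l.+1 l; last by rewrite subrr.
rewrite -(subnKC ln); elim: (n - l.+1)%N => [|d IHd]; first by rewrite addn0.
rewrite addnS -IHd; apply/eqP; rewrite -subr_eq0; apply/eqP.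
by apply: (hu (l.+1 + d)%N); rewrite leq_addr.
Qed.

End Topology.
#[global] Hint Resolve lspan_subspace tclosure_lspan_subspace deg_ge_0 : core.

(** * Homogeneous elements *)

Section Homogeneous.
Variables (F : fieldType) (E : algType F) (M : bimod E E).
Local Notation FM := (ctalg M).

(** Multiplication by [x] is already available as [tmul i x]; applying it to [1]
    places [x] in degree [i] without casts between the types [tpow M k]. *)
Definition hinj i (x : tpow M i) : FM := tmul i x 1.

Lemma tmulE i (x : tpow M i) (g : FM) : tmul i x g = hinj x * g.
Proof. by rewrite -[RHS]/(cmul _ _) cmul_tmul -[cmul _ _]/(1 * g) mul1r. Qed.

Lemma incl0D (s t : E) : incl0 M (s + t) = incl0 M s + incl0 M t.
Proof. by apply: dprodP => -[|k]; rewrite dprodDE //= addr0. Qed.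
Lemma incl0Z c (s : E) : incl0 M (c *: s) = c *: incl0 M s.
Proof. by apply: dprodP => -[|k]; rewrite dprodZE //= scaler0. Qed.
Lemma incl0_0 : incl0 M 0 = 0.
Proof. by rewrite -(scale0r 0) incl0Z scale0r. Qed.
Lemma incl0_1 : incl0 M 1 = 1.
Proof. by []. Qed.
Lemma incl0_sum (J : Type) (r : seq J) (Q : pred J) (u : J -> E) :
  incl0 M (\sum_(j <- r | Q j) u j) = \sum_(j <- r | Q j) incl0 M (u j).
Proof. by apply: (big_morph _ incl0D); exact: incl0_0. Qed.

Lemma hinj0 (s : tpow M 0) : hinj s = incl0 M s.
Proof.
apply: dprodP => -[|k]; first exact: mulr1.
exact: lact0r.
Qed.

Lemma incl0ME (s : E) (g : FM) k : (incl0 M s * g) k = lact (tpow M k) s (g k).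
Proof. by rewrite -(hinj0 s) -tmulE. Qed.

Lemma incl0M (s t : E) : incl0 M (s * t) = incl0 M s * incl0 M t.
Proof.
by apply: dprodP => -[|k]; rewrite incl0ME //; apply/esym; exact: lact0r.
Qed.

Lemma incl1E (m : M) (g : FM) : incl1 m * g = mshift m g.
Proof.
have e h : tmul 0 1 h = h by apply: dprodP => k; rewrite /= lact1.
have -> : incl1 m = hinj (tens m (1 : E) : tpow M 1).
  by rewrite /hinj tmul_tens e.
by rewrite -tmulE tmul_tens e.
Qed.

Lemma hinjS i (m : M) (y : tpow M i) :
  hinj (tens m y : tpow M i.+1) = incl1 m * hinj y.
Proof. by rewrite incl1E /hinj tmul_tens. Qed.

Lemma hinj_linear i c (x y : tpow M i) : hinj (c *: x + y) = c *: hinj x + hinj y.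
Proof. exact: tmul_linearl. Qed.
Lemma hinjD i (x y : tpow M i) : hinj (x + y) = hinj x + hinj y.
Proof. exact: tmulDl. Qed.
Lemma hinj_0 i : hinj (0 : tpow M i) = 0.
Proof. exact: tmul0l. Qed.

Lemma hinj_deg i (x : tpow M i) : deg_ge i (hinj x).
Proof. by move=> j ji; apply: tmul_lt. Qed.

Lemma hinj_ne i (x : tpow M i) k : k != i -> hinj x k = 0.
Proof.
move=> ki; rewrite /hinj -[1]/(incl0 M 1) tmul_incl0.
by case: eqP => // e; rewrite e eqxx in ki.
Qed.

Lemma hinj_id i (x : tpow M i) : hinj x i = x.
Proof.
rewrite /hinj -[1]/(incl0 M 1) tmul_incl0; case: eqP => // e.
by rewrite ract1 eq_axiomK.
Qed.

Lemma homogE (f : FM) i : homog f i = hinj (f i) :> FM.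
Proof.
apply: dprodP => k /=; case: eqP => [->|/eqP ne]; first by rewrite hinj_id.
by rewrite hinj_ne.
Qed.

Lemma talg_inj (x y : talg M) : x = y :> FM -> x = y.
Proof. exact: val_inj. Qed.
Lemma talgD (x y : talg M) : (x + y : talg M) = (x : FM) + (y : FM) :> FM.
Proof. by []. Qed.
Lemma talgM (x y : talg M) : (x * y : talg M) = (x : FM) * (y : FM) :> FM.
Proof. by []. Qed.

Lemma hinj_trunc (f : FM) n : deg_ge n (f - \sum_(i < n) hinj (f i)).
Proof.
move=> k kn; rewrite dprodDE dprodNE dprod_sumE (bigD1 (Ordinal kn)) //=.
rewrite hinj_id big1 ?addr0 ?subrr // => i ne; apply: hinj_ne.
by apply: contraNneq ne => ki; apply/eqP/val_inj.
Qed.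

Lemma incl1_linear c (m m' : M) : incl1 (c *: m + m') = c *: incl1 m + incl1 m'.
Proof. exact: mshift_linearl. Qed.
Lemma incl1D (m m' : M) : incl1 (m + m') = incl1 m + incl1 m'.
Proof. by have := incl1_linear 1 m m'; rewrite !scale1r. Qed.
Lemma incl1_0 : incl1 (0 : M) = 0.
Proof. by apply: (addrI (incl1 0)); rewrite -incl1D !addr0. Qed.

Lemma incl1_lact (s : E) (m : M) : incl1 (lact M s m) = incl0 M s * incl1 m.
Proof.
apply: dprodP => -[|k]; rewrite incl0ME /=; first by rewrite mulr0.
by rewrite tensor_lactE.
Qed.

Lemma incl1_ract (m : M) (s : E) : incl1 (ract M m s) = incl1 m * incl0 M s.
Proof.
rewrite incl1E; apply: dprodP => -[|[|k]] //=; last by rewrite !tens0r.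
by rewrite tens_bal /= mulr1.
Qed.

Lemma incl1_deg (m : M) : deg_ge 1 (incl1 m).
Proof. by case. Qed.

End Homogeneous.

(** * Algebra endomorphisms extending bimodule maps *)

Section Extension.
Variables (F : fieldType) (E : algType F) (M : bimod E E).
Local Notation FM := (ctalg M).

(** The condition on degrees makes the images of long words small, so that the
    extension to infinite sums converges. *)
Definition bimod_map (bt : M -> FM) : Prop :=
  [/\ linear bt,
      forall s m, bt (lact M s m) = incl0 M s * bt m,
      forall m s, bt (ract M m s) = bt m * incl0 M s &
      forall m, deg_ge 1 (bt m)].

Fixpoint hext (bt : M -> FM) (i : nat) : tpow M i -> FM :=
  if i is j.+1 return tpow M i -> FM then
    tlift (fun m y => bt m * hext bt y)
  else fun s => incl0 M s.

(** The image of a word of length [i > l] has no component of degree [l], so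
    the components of degree at most [l] suffice. *)
Definition ext (bt : M -> FM) (f : FM) : FM :=
  fun l => \sum_(i < l.+1) hext bt (f i) l.

Section Ext.
Variables (bt : M -> FM) (bt_bimod : bimod_map bt).

Let btP : linear bt. Proof. by case: bt_bimod. Qed.
Let bt_l s m : bt (lact M s m) = incl0 M s * bt m. Proof. by case: bt_bimod. Qed.
Let bt_r m s : bt (ract M m s) = bt m * incl0 M s. Proof. by case: bt_bimod. Qed.
Let bt_deg m : deg_ge 1 (bt m). Proof. by case: bt_bimod. Qed.

(** The two claims are proved together: the extension is well defined on
    [M] tensor [tpow M i] because the one on [tpow M i] is left linear. *)
Lemma hext_spec i : linear (@hext bt i) /\
  forall s (y : tpow M i), hext bt (lact (tpow M i) s y) = incl0 M s * hext bt y.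
Proof.
elim: i => [|i [IHl IHs]].
  by split=> [c s t|s t]; [rewrite /= incl0D incl0Z|exact: incl0M].
have bal : balanced (ract M) (lact (tpow M i)) (fun m y => bt m * hext bt y).
  split=> [y c m m'|m c y y'|m s y].
  - by rewrite btP mulrDl scalerAl.
  - by rewrite IHl mulrDr scalerAr.
  - by rewrite bt_r IHs mulrA.
have t0 : hext bt (0 : tpow M i.+1) = 0 by exact: tlift0 bal.
have tD (x y : tpow M i.+1) : hext bt (x + y) = hext bt x + hext bt y.
  exact: tliftD bal x y.
have tE m (y : tpow M i) : hext bt (tens m y : tpow M i.+1) = bt m * hext bt y.
  exact: tlift_tens bal m y.
split=> [|s y]; first exact: tlift_linear bal.
elim/tensor_ind: y => [|m y|x y IHx IHy].
- have -> : lact (tpow M i.+1) s 0 = 0 by exact: lact0r.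
  by rewrite t0 mulr0.
- by rewrite [lact _ _ _]tensor_lactE !tE bt_l mulrA.
- have -> : lact (tpow M i.+1) s (x + y) =
            lact (tpow M i.+1) s x + lact (tpow M i.+1) s y.
    by have := lact_linearr (tpow M i.+1) s 1 x y; rewrite !scale1r.
  by rewrite !tD mulrDr; congr (_ + _).
Qed.

Lemma hextP i : linear (@hext bt i).
Proof. by case: (hext_spec i). Qed.
Lemma hext_lact i s (y : tpow M i) :
  hext bt (lact (tpow M i) s y) = incl0 M s * hext bt y.
Proof. by case: (hext_spec i). Qed.
Lemma hextD i (x y : tpow M i) : hext bt (x + y) = hext bt x + hext bt y.
Proof. by have := hextP 1 x y; rewrite !scale1r. Qed.
Lemma hext0 i : hext bt (0 : tpow M i) = 0.
Proof. by apply: (addrI (hext bt (0 : tpow M i))); rewrite -hextD !addr0. Qed.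

Lemma hextS i m (y : tpow M i) :
  hext bt (tens m y : tpow M i.+1) = bt m * hext bt y.
Proof.
apply: (@tlift_tens _ _ _ _ (ract M) (lact (tpow M i)) _ (fun m y => bt m * hext bt y)).
split=> [{}y c {}m m'|{}m c {}y y'|{}m s {}y].
- by rewrite btP mulrDl scalerAl.
- by rewrite hextP mulrDr scalerAr.
- by rewrite bt_r hext_lact mulrA.
Qed.

Lemma hext_deg i (x : tpow M i) : deg_ge i (hext bt x).
Proof.
elim/tpow_ind: i / x => [i|i x y IHx IHy|s|i m y IHy].
- by rewrite hext0.
- by rewrite hextD; apply: deg_geD.
- by [].
- by rewrite hextS -add1n; apply: deg_geM (bt_deg m) IHy.
Qed.

Lemma ext_linear : linear (ext bt).
Proof.
move=> c f g; apply: dprodP => l; rewrite dprodDE dprodZE /ext.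
rewrite scaler_sumr -big_split; apply: eq_bigr => i _ /=.
by rewrite dprodDE dprodZE hextP.
Qed.
Lemma extD f g : ext bt (f + g) = ext bt f + ext bt g.
Proof. by have := ext_linear 1 f g; rewrite !scale1r. Qed.
Lemma ext0 : ext bt 0 = 0.
Proof. by apply: (addrI (ext bt 0)); rewrite -extD !addr0. Qed.
Lemma extN f : ext bt (- f) = - ext bt f.
Proof. by apply: (addrI (ext bt f)); rewrite -extD !subrr ext0. Qed.
Lemma extB f g : ext bt (f - g) = ext bt f - ext bt g.
Proof. by rewrite extD extN. Qed.
Lemma ext_sum (J : Type) (r : seq J) (Q : pred J) (u : J -> FM) :
  ext bt (\sum_(j <- r | Q j) u j) = \sum_(j <- r | Q j) ext bt (u j).
Proof. by apply: (big_morph _ extD); exact: ext0. Qed.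

Lemma ext_deg k f : deg_ge k f -> deg_ge k (ext bt f).
Proof.
move=> hf l lk; rewrite /ext big1 // => i _.
by rewrite hf ?hext0 //; apply: leq_ltn_trans lk; rewrite -ltnS.
Qed.

Lemma ext_hinj i (x : tpow M i) : ext bt (hinj x) = hext bt x.
Proof.
apply: dprodP => l; rewrite /ext; have [il|li] := leqP i l.
  rewrite (bigD1 (Ordinal (il : (i < l.+1)%N))) //= hinj_id.
  by rewrite big1 ?addr0 // => j ne; rewrite hinj_ne ?hext0.
rewrite big1 ?hext_deg // => j _; rewrite hinj_ne ?hext0 //.
by apply: contraTneq li => <-; rewrite -leqNgt -ltnS.
Qed.

Lemma ext_trunc f n : deg_ge n (ext bt f - \sum_(i < n) hext bt (f i)).
Proof.
have -> : \sum_(i < n) hext bt (f i) = ext bt (\sum_(i < n) hinj (f i)).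
  by rewrite ext_sum; apply: eq_bigr => i _; rewrite ext_hinj.
by rewrite -extB; apply/ext_deg/hinj_trunc.
Qed.

Lemma ext_incl0 s : ext bt (incl0 M s) = incl0 M s.
Proof. by rewrite -(hinj0 (s : tpow M 0)) ext_hinj hinj0. Qed.

Lemma ext_incl0M s f : ext bt (incl0 M s * f) = incl0 M s * ext bt f.
Proof.
apply: dprodP => l; rewrite incl0ME /ext.
rewrite (big_morph (lact (tpow M l) s) (id1 := 0) (op1 := +%R)).
- by apply: eq_bigr => i _; rewrite incl0ME hext_lact incl0ME.
- by move=> x y; have := lact_linearr (tpow M l) s 1 x y; rewrite !scale1r.
- exact: lact0r.
Qed.

Lemma ext_incl1M m f : ext bt (incl1 m * f) = bt m * ext bt f.
Proof.
apply/eqP; rewrite -subr_eq0; apply/eqP/deg_ge_eq0 => n.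
have tr := @ext_trunc (incl1 m * f) n.+1; have tr' := @ext_trunc f n.
have e : \sum_(i < n.+1) hext bt ((incl1 m * f) i) =
    bt m * \sum_(i < n) hext bt (f i).
  rewrite big_ord_recl incl1E [mshift m f _]/= hext0 add0r mulr_sumr.
  by apply: eq_bigr => i _; exact: hextS.
rewrite e in tr.
have -> : ext bt (incl1 m * f) - bt m * ext bt f =
    (ext bt (incl1 m * f) - bt m * (\sum_(i < n) hext bt (f i))) -
    bt m * (ext bt f - \sum_(i < n) hext bt (f i)).
  by rewrite mulrBr opprB addrA subrK.
apply: deg_geB; last exact: deg_geMl.
exact: deg_geW tr.
Qed.

Lemma ext_hinjM i (x : tpow M i) f : ext bt (hinj x * f) = hext bt x * ext bt f.
Proof.
elim/tpow_ind: i / x f => [i|i x y IHx IHy|s|i m y IHy] f.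
- by rewrite hinj_0 hext0 !mul0r ext0.
- by rewrite hinjD hextD !mulrDl extD IHx IHy.
- by rewrite hinj0 ext_incl0M.
- by rewrite hinjS hextS -!mulrA ext_incl1M IHy.
Qed.

(** Both sides depend continuously on [f], and they agree when [f] is a finite
    sum of homogeneous elements. *)
Lemma extM f g : ext bt (f * g) = ext bt f * ext bt g.
Proof.
apply/eqP; rewrite -subr_eq0; apply/eqP/deg_ge_eq0 => n.
set h := \sum_(i < n) hinj (f i).
have hM : ext bt (h * g) = ext bt h * ext bt g.
  rewrite mulr_suml !ext_sum mulr_suml; apply: eq_bigr => i _.
  by rewrite ext_hinjM ext_hinj.
have -> : ext bt (f * g) - ext bt f * ext bt g =
    ext bt ((f - h) * g) - ext bt (f - h) * ext bt g.
  by rewrite mulrBl !extB mulrBl hM opprB addrA subrK.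
have hfh := @hinj_trunc _ _ _ f n.
by apply: deg_geB; [apply: ext_deg|]; apply: deg_geMr => //; apply: ext_deg.
Qed.

Lemma ext1 : ext bt 1 = 1.
Proof. exact: ext_incl0 1. Qed.

(** The map [1 - ext bt] raises degrees, so the geometric series inverts
    [ext bt]. *)
Lemma ext_bij : (forall m, deg_ge 2 (bt m - incl1 m)) -> bijective (ext bt).
Proof.
move=> bt2.
have hext_hinj i (x : tpow M i) : deg_ge i.+1 (hext bt x - hinj x).
  elim/tpow_ind: i / x => [i|i x y IHx IHy|s|i m y IHy].
  - by rewrite hext0 hinj_0 subrr.
  - by rewrite hextD hinjD opprD addrACA; apply: deg_geD.
  - by rewrite hinj0 subrr.
  - have -> : hext bt (tens m y : tpow M i.+1) - hinj (tens m y : tpow M i.+1) =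
        (bt m - incl1 m) * hext bt y + incl1 m * (hext bt y - hinj y).
      by rewrite hextS hinjS mulrBl mulrBr addrA subrK.
    apply: deg_geD; first by have := deg_geM (bt2 m) (hext_deg y); rewrite add2n.
    by have := deg_geM (@incl1_deg _ _ _ m) IHy; rewrite add1n.
have raise k f : deg_ge k f -> deg_ge k.+1 (f - ext bt f).
  move=> hf; rewrite -opprB; apply: deg_geN.
  have -> : ext bt f - f = (ext bt f - \sum_(i < k.+1) hext bt (f i)) -
      (f - \sum_(i < k.+1) hinj (f i)) +
      \sum_(i < k.+1) (hext bt (f i) - hinj (f i)).
    by rewrite sumrB opprB addrAC !addrA !subrK.
  apply: deg_geD; first exact/deg_geB/hinj_trunc/ext_trunc.
  apply: deg_ge_sum => i _; have [ik|ki] := ltnP i k.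
    by rewrite hf // hext0 hinj_0 subrr.
  by apply: (deg_geW _ (hext_hinj _ _)); rewrite ltnS.
pose N g := g - ext bt g.
have iterN g k : deg_ge k (iter k N g) by elim: k => // k IHk; apply: raise.
pose inv g := diag_lim (fun n => \sum_(k < n) iter k N g).
have invP g n : deg_ge n (inv g - \sum_(k < n) iter k N g).
  by apply: diag_limP => {}n; rewrite big_ord_recr /= addrAC subrr add0r.
have ext_inv g : ext bt (inv g) = g.
  apply/eqP; rewrite -subr_eq0; apply/eqP/deg_ge_eq0 => n.
  have -> : ext bt (inv g) - g = ext bt (inv g - \sum_(k < n) iter k N g) -
      iter n N g.
    rewrite extB; suff -> : ext bt (\sum_(k < n) iter k N g) = g - iter n N g.
      by rewrite opprB addrA addrAC addrK.
    elim: n => [|n IHn]; first by rewrite big_ord0 ext0 subrr.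
    by rewrite big_ord_recr /= extD IHn /N opprB addrA addrAC.
  by apply: deg_geB => //; apply/ext_deg/invP.
have ext_inj f : ext bt f = 0 -> f = 0.
  move=> f0; apply: deg_ge_eq0; elim=> // k IHk.
  by have := raise k f IHk; rewrite f0 subr0.
exists inv => // f; apply/eqP; rewrite -subr_eq0; apply/eqP/ext_inj.
by rewrite extB ext_inv subrr.
Qed.

End Ext.
End Extension.

(** * Cyclic equivalence *)

Section Ideals.
Variables (F : fieldType) (E : algType F) (M : bimod E E).
Local Notation FM := (ctalg M).
Implicit Types (f g h : FM) (S : set FM).

Lemma commutators_subspace : subspace (@commutators F E M).
Proof. exact: tclosure_lspan_subspace. Qed.

Lemma commutators_mem f g : commutators (f * g - g * f).
Proof. by apply: tclosure_lspan_mem; exists f, g. Qed.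

Lemma cyc_equivC f g : cyc_equiv (f * g) (g * f).
Proof. exact: commutators_mem. Qed.

Lemma cyc_equiv_refl f : cyc_equiv f f.
Proof. by rewrite /cyc_equiv subrr; apply: subspace0 commutators_subspace. Qed.

Lemma cyc_equivS f g : cyc_equiv f g -> cyc_equiv g f.
Proof. by rewrite /cyc_equiv -(opprB f g); apply: subspaceN commutators_subspace _. Qed.

Lemma cyc_equivT f g h : cyc_equiv f g -> cyc_equiv g h -> cyc_equiv f h.
Proof.
move=> fg gh; rewrite /cyc_equiv -(subrK g f) -addrA.
exact: (subspaceD commutators_subspace).
Qed.

Lemma cyc_equivP c f g f' g' : cyc_equiv f f' -> cyc_equiv g g' ->
  cyc_equiv (c *: f + g) (c *: f' + g').
Proof.
move=> ff gg; rewrite /cyc_equiv opprD addrACA -scalerBr.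
exact: (subspaceP commutators_subspace).
Qed.

Lemma cyc_equivD f g f' g' : cyc_equiv f f' -> cyc_equiv g g' ->
  cyc_equiv (f + g) (f' + g').
Proof. by move=> ff gg; have := cyc_equivP 1 ff gg; rewrite !scale1r. Qed.

Lemma cyc_equivN f f' : cyc_equiv f f' -> cyc_equiv (- f) (- f').
Proof.
by rewrite /cyc_equiv -opprD; apply: subspaceN commutators_subspace _.
Qed.

Lemma cyc_equivB f g f' g' : cyc_equiv f f' -> cyc_equiv g g' ->
  cyc_equiv (f - g) (f' - g').
Proof. by move=> ff gg; apply: cyc_equivD => //; apply: cyc_equivN. Qed.

Lemma cyc_equiv_sum (J : Type) (r : seq J) (Q : pred J) (u v : J -> FM) :
  (forall j, Q j -> cyc_equiv (u j) (v j)) ->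
  cyc_equiv (\sum_(j <- r | Q j) u j) (\sum_(j <- r | Q j) v j).
Proof.
move=> uv; elim/big_ind2: _ => //; first exact: cyc_equiv_refl.
by move=> f f' g g'; apply: cyc_equivD.
Qed.

Lemma cyc_equiv_approx f g :
  (forall n, exists f' g', [/\ deg_ge n (f - f'), deg_ge n (g - g') &
     cyc_equiv f' g']) -> cyc_equiv f g.
Proof.
move=> h; apply: tclosure_approx => n; have [f' [g' [ff gg fg]]] := h n.
by exists (f' - g') => //; rewrite opprD addrACA -opprD; exact: deg_geB.
Qed.

(** * Closed subspaces and finite dimension *)

(** A line plus a closed subspace is closed. If [u] is a limit of elements of
    [S], then so is [c *: u]. Otherwise [u] stays at a fixed distance from [S],
    and the coefficients of [u] in approximations of [f] that are finer than
    this distance all coincide. *)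
Lemma tclosure_add_line S (u f : FM) : subspace S ->
  tclosure (fun g : FM => exists c : F, S (g - c *: u)) f ->
  exists c : F, tclosure S (f - c *: u).
Proof.
move=> subS cf.
have [[N uN]|uS] := EM (exists N, forall g, S g -> ~ deg_ge N (u - g)); last first.
  exists 0; rewrite scale0r subr0 => N; have [g [c Sg] fg] := cf N.
  have [h Sh uh] : exists2 h, S h & deg_ge N (u - h).
    apply: contrapT => nh; apply: uS; exists N => h Sh uh.
    by apply: nh; exists h.
  exists (c *: h + (g - c *: u)); first exact: subspaceP.
  have -> : f - (c *: h + (g - c *: u)) = c *: (u - h) + (f - g).
    rewrite scalerBr opprD opprB addrCA [f + (_ + _)]addrCA addrA.
    by congr (_ + _); exact: addrC.
  exact: deg_geP.
have [g0 [c0 Sg0] fg0] := cf N; exists c0 => n.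
have [g [c Sg] fg] := cf (maxn N n).
suff e : c = c0.
  exists (g - c *: u) => //; rewrite -e opprB addrA subrK.
  exact: deg_geW (leq_maxr _ _) fg.
apply: contrapT => /eqP; rewrite -subr_eq0 => ne.
apply: (uN ((c - c0)^-1 *: ((g0 - c0 *: u) - (g - c *: u)))).
  by apply: subspaceZ => //; apply: subspaceB.
have -> : u - (c - c0)^-1 *: (g0 - c0 *: u - (g - c *: u)) =
    (c - c0)^-1 *: (g - g0).
  rewrite -{1}[u](scalerK ne) -scalerBr; congr (_ *: _).
  have -> : g0 - c0 *: u - (g - c *: u) = (c - c0) *: u - (g - g0).
    by rewrite scalerBl !opprB addrACA [RHS]addrACA [g0 + _]addrC.
  by rewrite subKr.
rewrite -[_ *: _]addr0; apply: deg_geP => //; rewrite -[g - g0]opprB.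
apply: deg_geN; have -> : g0 - g = (f - g) - (f - g0).
  by rewrite opprB [RHS]addrC addrA subrK.
by apply: deg_geB => //; apply: deg_geW (leq_maxl _ _) fg.
Qed.

Lemma tclosure_add_seq S (s : seq FM) f : subspace S ->
  tclosure (fun g : FM => exists2 h, lspan [set` s] h & S (g - h)) f ->
  exists2 h, lspan [set` s] h & tclosure S (f - h).
Proof.
move=> subS; elim: s f => [|u s IHs] f cf.
  exists 0; first by exists [::]; split=> //; rewrite big_nil.
  rewrite subr0; apply: tclosureS cf => g /= [h].
  move=> [[|p t] [hp ->]]; first by rewrite big_nil subr0.
  by have := hp p (mem_head _ _).
pose S' : set FM := fun g => exists2 h, lspan [set` s] h & S (g - h).
have subS' : subspace S'.
  split=> [|c g g' [h hs Sh] [h' hs' Sh']].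
    by exists 0; [exact: subspace0|rewrite subr0; exact: subspace0].
  exists (c *: h + h'); first exact: subspaceP.
  by rewrite opprD addrACA -scalerBr; apply: subspaceP.
have [c cS'] : exists c : F, tclosure S' (f - c *: u).
  apply: tclosure_add_line => //; apply: tclosureS cf => g [h hs Sh].
  have [c hc] : exists c : F, lspan [set` s] (h - c *: u).
    move: hs; apply: (lspan_min (U :=
      fun h : FM => exists c, lspan [set` s] (h - c *: u))).
      split=> [|a h1 h2 [c1 hc1] [c2 hc2]].
        by exists 0; rewrite scale0r subr0; apply: subspace0.
      exists (a * c1 + c2); rewrite scalerDl -scalerA opprD addrACA -scalerBr.
      exact: subspaceP.
    move=> v /=; rewrite inE => /orP[/eqP ->|vs].
      by exists 1; rewrite scale1r subrr; apply: subspace0.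
    by exists 0; rewrite scale0r subr0; apply: lspan_mem.
  by exists c, (h - c *: u) => //; rewrite opprB addrA subrK.
have [h hs Sh] := IHs _ cS'; exists (c *: u + h).
  apply: subspaceP => //; first by apply: lspan_mem; rewrite /= mem_head.
  by apply: lspanS hs => v /= vs; rewrite inE vs orbT.
by rewrite opprD addrA.
Qed.

Lemma lspan_mul S1 S2 f g : lspan S1 f -> lspan S2 g ->
  lspan [set h | exists a b, [/\ S1 a, S2 b & h = a * b]] (f * g).
Proof.
move=> [s [sS ->]] [t [tS ->]]; rewrite mulr_suml big_seq.
apply: subspace_sum => // p ps; rewrite mulr_sumr big_seq.
apply: subspace_sum => // q qt; rewrite -scalerAl -scalerAr scalerA.
apply: subspaceZ => //; apply: lspan_mem; exists p.2, q.2.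
by split=> //; [exact: sS|exact: tS].
Qed.

Definition mul_seq (s t : seq FM) : seq FM := [seq a * b | a <- s, b <- t].

Lemma lspan_mul_seq (s t : seq FM) f g :
  lspan [set` s] f -> lspan [set` t] g -> lspan [set` mul_seq s t] (f * g).
Proof.
move=> fs gt; apply: lspanS (lspan_mul fs gt) => _ [a [b [/= sa tb ->]]].
by apply/allpairsP; exists (a, b).
Qed.

(** Finite dimension, for modules that come without a chosen basis, such as a
    product of algebras. *)
Definition fin_span (W : lmodType F) : Prop :=
  exists s : seq W, forall w, exists c : nat -> F, w = \sum_(k < size s) c k *: s`_k.

Lemma fin_span_img (W : lmodType F) (k : W -> FM) :
  (forall c x y, k (c *: x + y) = c *: k x + k y) -> fin_span W ->
  exists2 s : seq FM, (forall f, f \in s -> exists w, f = k w) &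
    forall w, lspan [set` s] (k w).
Proof.
move=> kP [s sP]; exists [seq k w | w <- s] => [f /mapP[w _ ->]|w].
  by exists w.
have [c ->] := sP w.
have k0 : k 0 = 0.
  by apply: (addrI (k 0)); have := kP 1 0 0; rewrite !scale1r !addr0.
elim/big_ind: _ => [|x y hx hy|j _]; first by rewrite k0; apply: subspace0.
  by rewrite -[x]scale1r kP; apply: subspaceP.
rewrite -[_ *: _]addr0 kP k0 addr0; apply: subspaceZ => //; apply: lspan_mem.
by apply/mapP; exists s`_j => //; apply: mem_nth.
Qed.

Lemma hinj_span i : fin_span E -> fin_span M ->
  exists2 s : seq FM, (forall f, f \in s -> exists x : tpow M i, f = hinj x) &
    forall x : tpow M i, lspan [set` s] (hinj x).
Proof.
move=> fE fM; elim: i => [|i [s sH sP]].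
  apply: (@fin_span_img E (fun x => hinj (x : tpow M 0))) => // c x y.
  exact: hinj_linear.
have [t tH tP] := fin_span_img (@incl1_linear F E M) fM.
exists (mul_seq t s) => [f /allpairsP[[a b] /= [ta sb ->]]|x].
  have [[m ->] [y ->]] := (tH a ta, sH b sb).
  by exists (tens m y); rewrite hinjS.
elim/tensor_ind: x => [|m y|x y hx hy].
- by rewrite hinj_0; apply: subspace0.
- by rewrite hinjS; apply: lspan_mul_seq.
- by rewrite hinjD; apply: subspaceD.
Qed.

(** * Powers of the Jacobian ideal up to cyclic equivalence *)

Section Jacobian.
Variables (aI : finType) (X : aI -> FM).

(** The filtration J_k of the closed ideal generated by the [X a], by the
    degree of what surrounds the generator. *)
Definition Jfil (k : nat) : set FM := tclosure (lspan [set h | exists p q a x y,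
  [/\ (k <= p + q)%N, deg_ge p x, deg_ge q y & h = x * X a * y]]).

Lemma Jfil_subspace k : subspace (Jfil k).
Proof. exact: tclosure_lspan_subspace. Qed.
Hint Resolve Jfil_subspace : core.

Lemma Jfil_gen k p q a x y : (k <= p + q)%N -> deg_ge p x -> deg_ge q y ->
  Jfil k (x * X a * y).
Proof. by move=> kpq xp yq; apply: tclosure_lspan_mem; exists p, q, a, x, y. Qed.

Lemma JfilW j k f : (j <= k)%N -> Jfil k f -> Jfil j f.
Proof.
move=> jk; apply/tclosureS/lspanS => _ [p [q [a [x [y [kpq xp yq ->]]]]]].
by exists p, q, a, x, y; split=> //; apply: leq_trans kpq.
Qed.

Lemma JfilMr k e f g : Jfil k f -> deg_ge e g -> Jfil (k + e) (f * g).
Proof.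
move=> Jf ge; apply: tclosure_approx => N; have [f' Jf' ff'] := Jf N.
exists (f' * g); last by rewrite -mulrBl; apply: deg_geMr.
move: Jf'; apply: (lspan_min (U := [set f' | Jfil (k + e) (f' * g)])).
  split=> [|c u v hu hv] /=; first by rewrite mul0r; exact: subspace0 (Jfil_subspace _).
  by rewrite mulrDl -scalerAl; apply: (subspaceP (Jfil_subspace _)).
move=> _ [p [q [a [x [y [kpq xp yq ->]]]]]] /=; rewrite -mulrA.
apply: (@Jfil_gen _ p (q + e)) => //; last exact: deg_geM.
by rewrite addnA leq_add2r.
Qed.

Lemma JfilMl k e f g : deg_ge e g -> Jfil k f -> Jfil (k + e) (g * f).
Proof.
move=> ge Jf; apply: tclosure_approx => N; have [f' Jf' ff'] := Jf N.
exists (g * f'); last by rewrite -mulrBr; apply: deg_geMl.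
move: Jf'; apply: (lspan_min (U := [set f' | Jfil (k + e) (g * f')])).
  split=> [|c u v hu hv] /=; first by rewrite mulr0; exact: subspace0 (Jfil_subspace _).
  by rewrite mulrDr -scalerAr; apply: (subspaceP (Jfil_subspace _)).
move=> _ [p [q [a [x [y [kpq xp yq ->]]]]]] /=; rewrite !mulrA.
apply: (@Jfil_gen _ (e + p) q) => //; last exact: deg_geM.
by rewrite addnC -addnA leq_add2l.
Qed.

Lemma Jfil_deg d k f : (forall a, deg_ge d (X a)) -> Jfil k f -> deg_ge (k + d) f.
Proof.
move=> Xd; apply: tclosure_deg_ge => _ [p [q [a [x [y [kpq xp yq ->]]]]]].
apply: (@deg_geW _ _ _ _ (p + d + q)); last by do 2!apply: deg_geM => //.
by rewrite addnAC leq_add2r.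
Qed.

Lemma Jfil_closed k f :
  (forall N, exists2 g, Jfil k g & deg_ge N (f - g)) -> Jfil k f.
Proof. exact: tclosure_approx. Qed.

(** The sums of [C a * X a] are the first order variations of a potential
    whose cyclic derivatives are the [X a]; here the variations are of size
    J_n. *)
Definition Gfil (n : nat) (h : FM) : Prop := exists2 C : aI -> FM,
  forall a, Jfil n (C a) & cyc_equiv h (\sum_a C a * X a).

Lemma Gfil_subspace n : subspace (Gfil n).
Proof.
split=> [|c f g [C JC fC] [D JD gD]].
  exists (fun=> 0); first by move=> a; exact: subspace0 (Jfil_subspace _).
  by rewrite big1 => [|a _]; [exact: cyc_equiv_refl|rewrite mul0r].
exists (fun a => c *: C a + D a); first by move=> a; apply: (subspaceP (Jfil_subspace _)).
under eq_bigr do rewrite mulrDl -scalerAl.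
by rewrite big_split /= -scaler_sumr; apply: cyc_equivP.
Qed.
Hint Resolve Gfil_subspace : core.

Lemma Gfil_cyc n f g : cyc_equiv f g -> Gfil n g -> Gfil n f.
Proof. by move=> fg [C JC gC]; exists C => //; apply: cyc_equivT gC. Qed.

Lemma Gfil_gen n (C : FM) b : Jfil n C -> Gfil n (C * X b).
Proof.
move=> JC; exists (fun a => if a == b then C else 0) => [a|].
  by case: eqP => // _; exact: subspace0 (Jfil_subspace _).
rewrite (bigD1 b) //= eqxx big1 ?addr0; first exact: cyc_equiv_refl.
by move=> a /negPf ->; rewrite mul0r.
Qed.

(** Generators of the products J_p J_q with [p + q = n]. Keeping the three outer
    factors separate makes the quotients of this filtration visibly
    finite-dimensional. *)
Definition two_X (n : nat) : set FM := [set h | exists p q r a b x y z,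
  [/\ (n <= p + q + r)%N, deg_ge p x, deg_ge q y, deg_ge r z &
      h = x * X a * y * X b * z]].

Lemma two_X_deg n f : tclosure (lspan (two_X n)) f -> deg_ge n f.
Proof.
apply: tclosure_deg_ge => _ [p [q [r [a [b [x [y [z [npq xp yq zr ->]]]]]]]]].
apply: deg_geW npq _; apply: deg_geM => //; apply: deg_geMr.
by apply: deg_geM => //; apply: deg_geMr.
Qed.

Hypotheses (fE : fin_span E) (fM : fin_span M).

(** Modulo the next step of the filtration, each outer factor may be replaced by
    its leading component, which lies in a finite-dimensional space.
    Rotating [x * X a * y * X b * z] gives [(z * x * X a * y) * X b]. *)
Lemma two_X_lead n : exists2 s : seq FM, (forall f, f \in s -> Gfil n f) &
  forall f, two_X n f ->
    exists2 g, lspan [set` s] g & lspan (two_X n.+1) (f - g).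
Proof.
have hW i : exists s : seq FM,
    (forall f, f \in s -> exists x : tpow M i, f = hinj x) /\
    (forall x : tpow M i, lspan [set` s] (hinj x)).
  by have [s] := hinj_span i fE fM; exists s.
have [W WP] := choice hW.
pose Xs := [seq X a | a <- enum aI].
have XsX a : lspan [set` Xs] (X a).
  by apply: (@lspan_mem _ _ _ [set` Xs]); apply: (map_f X); rewrite mem_enum.
pose B p q r := mul_seq (mul_seq (mul_seq (mul_seq (W p) Xs) (W q)) Xs) (W r).
pose t := [seq t <- enum ({: 'I_n.+1 * 'I_n.+1 * 'I_n.+1}) |
             (val t.1.1 + val t.1.2 + val t.2 == n)%N].
exists (flatten [seq B (val t.1.1) (val t.1.2) (val t.2) | t <- t]).
  move=> f /flatten_mapP[[[p q] r]]; rewrite mem_filter /= => /andP[/eqP pqr _].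
  move=> /allpairsP[[f4 z] /= [/allpairsP[[f3 x2] /= [/allpairsP[[f2 y] /=
    [/allpairsP[[x x1] /= [xW x1X ->]] yW ->]] x2X ->]] zW ->]].
  have [[x' ->] [y' ->] [z' ->]] :
    [/\ exists x' : tpow M p, x = hinj x', exists y' : tpow M q, y = hinj y' &
        exists z' : tpow M r, z = hinj z'].
    by split; [case: (WP p)|case: (WP q)|case: (WP r)] => h _; apply: h.
  case/mapP: x1X => a _ ->; case/mapP: x2X => b _ ->.
  apply: Gfil_cyc (cyc_equivC _ _) _; rewrite mulrA; apply: Gfil_gen.
  rewrite !mulrA; apply: (@Jfil_gen _ (r + p) q).
  - by apply: (leq_trans (eq_leq (esym pqr))); rewrite -(addnA r) (addnC r).
  - by apply: deg_geM; exact: hinj_deg.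
  - exact: hinj_deg.
move=> f [p [q [r [a [b [x [y [z [npq xp yq zr fE']]]]]]]]].
have [lt|le] := ltnP n (p + q + r).
  exists 0; [exact: subspace0|rewrite subr0; apply: lspan_mem].
  by exists p, q, r, a, b, x, y, z.
have en : (p + q + r)%N = n by apply/eqP; rewrite eqn_leq le npq.
have lead k (w : FM) : deg_ge k w -> deg_ge k.+1 (w - hinj (w k)).
  move=> wk j; rewrite ltnS leq_eqVlt dprodDE dprodNE => /orP[/eqP ->|jk].
    by rewrite hinj_id subrr.
  by rewrite wk // hinj_ne ?subr0 // ltn_eqF.
exists (hinj (x p) * X a * hinj (y q) * X b * hinj (z r)).
  have Bpqr : lspan [set` B p q r]
      (hinj (x p) * X a * hinj (y q) * X b * hinj (z r)).
    by do 4?apply: lspan_mul_seq => //; [case: (WP p)|case: (WP q)|case: (WP r)].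
  apply: lspanS Bpqr => g /= Bg.
  have [pn qn rn] : [/\ (p < n.+1)%N, (q < n.+1)%N & (r < n.+1)%N].
    by rewrite !ltnS -en; split; rewrite ?leq_addl // -addnA ?leq_addr //
       addnCA leq_addr.
  apply/flatten_mapP; exists (Ordinal pn, Ordinal qn, Ordinal rn) => //.
  by rewrite mem_filter /= en eqxx mem_enum.
have -> : f - hinj (x p) * X a * hinj (y q) * X b * hinj (z r) =
    (x - hinj (x p)) * X a * y * X b * z +
    (hinj (x p) * X a * (y - hinj (y q)) * X b * z +
     hinj (x p) * X a * hinj (y q) * X b * (z - hinj (z r))).
  by rewrite fE' !mulrBr !mulrBl !addrA !subrK.
apply: subspaceD => //; last apply: subspaceD => //; apply: lspan_mem.
- exists p.+1, q, r, a, b, (x - hinj (x p)), y, z; split=> //; last exact: lead.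
- exists p, q.+1, r, a, b, (hinj (x p)), (y - hinj (y q)), z; split=> //.
  + by rewrite -en addnS addSn.
  + exact: hinj_deg.
  + exact: lead.
- exists p, q, r.+1, a, b, (hinj (x p)), (hinj (y q)), (z - hinj (z r)); split=> //.
  + by rewrite -en addnS.
  + exact: hinj_deg.
  + exact: hinj_deg.
  + exact: lead.
Qed.

Lemma two_X_step n f : tclosure (lspan (two_X n)) f ->
  exists2 f', tclosure (lspan (two_X n.+1)) f' & Gfil n (f - f').
Proof.
move=> cf; have [s sG sP] := two_X_lead n.
have [h hs hU] : exists2 h, lspan [set` s] h &
    tclosure (lspan (two_X n.+1)) (f - h).
  apply: tclosure_add_seq => //; apply: tclosureS cf; apply: lspan_min => //.
  split=> [|c u v [u' us hu] [v' vs hv]].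
    by exists 0; [exact: subspace0|rewrite subr0; exact: subspace0].
  exists (c *: u' + v'); first exact: subspaceP.
  by rewrite opprD addrACA -scalerBr; apply: subspaceP.
exists (f - h) => //; rewrite opprB addrC subrK.
by move: hs; apply: lspan_min.
Qed.

(** Peeling off one degree at a time writes [f] as a sum of elements
    [u d - u d.+1] of [Gfil (n + d)]; their coefficients lie in J_(n + d), so
    they can be summed. *)
Lemma two_X_Gfil n f : tclosure (lspan (two_X n)) f -> Gfil n f.
Proof.
move=> cf.
have hnx (t : nat * FM) : exists g', tclosure (lspan (two_X t.1)) t.2 ->
    tclosure (lspan (two_X t.1.+1)) g' /\ Gfil t.1 (t.2 - g').
  case: t => k g; have [/two_X_step[g' cg' Gg]|ncg] :=
    EM (tclosure (lspan (two_X k)) g); last by exists 0.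
  by exists g'.
have [nx nxP] := choice hnx.
pose u := fix u d := if d is d'.+1 then nx (n + d', u d')%N else f.
have uU d : tclosure (lspan (two_X (n + d))) (u d).
  elim: d => [|d IHd]; first by rewrite addn0.
  by rewrite addnS; have [] := nxP (n + d, u d)%N IHd.
have uG d : Gfil (n + d) (u d - u d.+1) by have [] := nxP (n + d, u d)%N (uU d).
have hC d : exists C : aI -> FM, (forall a, Jfil (n + d) (C a)) /\
    cyc_equiv (u d - u d.+1) (\sum_a C a * X a).
  by have [C] := uG d; exists C.
have [C CP] := choice hC.
pose S a N := \sum_(d < N) C d a.
have SP a N : deg_ge N (diag_lim (S a) - S a N).
  apply: diag_limP => {}N; rewrite /S big_ord_recr /= addrAC subrr add0r.
  have [/(_ a) JC _] := CP N; have := Jfil_deg (fun b => deg_ge0 (X b)) JC.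
  by rewrite addn0; apply: deg_geW; rewrite leq_addl.
exists (fun a => diag_lim (S a)) => [a|].
  apply: Jfil_closed => N; exists (S a N) => //.
  apply: (subspace_sum (Jfil_subspace _)) => d _.
  have [/(_ a) JC _] := CP d; apply: JfilW JC; exact: leq_addr.
apply: cyc_equiv_approx => N; exists (f - u N), (\sum_a S a N * X a); split.
- rewrite opprB addrC subrK.
  by apply: (deg_geW _ (two_X_deg (uU N))); rewrite leq_addl.
- rewrite -sumrB; apply: deg_ge_sum => a _; rewrite -mulrBl.
  by apply: deg_geMr; apply: SP.
have -> : f - u N = \sum_(d < N) (u d - u d.+1).
  by elim: N => [|N IHN]; rewrite ?big_ord0 ?subrr // big_ord_recr /= -IHN addrA subrK.
have -> : \sum_a S a N * X a = \sum_(d < N) \sum_a C d a * X a.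
  by rewrite exchange_big; apply: eq_bigr => a _; rewrite mulr_suml.
by apply: cyc_equiv_sum => d _; have [] := CP d.
Qed.

Lemma Jfil_mul_two_X p q f g : Jfil p f -> Jfil q g ->
  tclosure (lspan (two_X (p + q))) (f * g).
Proof.
move=> Jf Jg N; have [[f' Jf' ff'] [g' Jg' gg']] := (Jf N, Jg N).
exists (f' * g'); last first.
  have -> : f * g - f' * g' = (f - f') * g + f' * (g - g').
    by rewrite mulrBl mulrBr addrA subrK.
  by apply: deg_geD; [exact: deg_geMr|exact: deg_geMl].
apply: lspanS (lspan_mul Jf' Jg') => _ [_ [_ [[p1 [q1 [a [x [y [h1 xp yq ->]]]]]]
  [p2 [q2 [b [x' [y' [h2 xp' yq' ->]]]]]] ->]]].
exists p1, (q1 + p2)%N, q2, a, b, x, (y * x'), y'; split=> //.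
- by rewrite addnA -addnA leq_add.
- exact: deg_geM.
- by rewrite !mulrA.
Qed.

Lemma Jfil_mul_Gfil p q f g : Jfil p f -> Jfil q g -> Gfil (p + q) (f * g).
Proof. by move=> Jf Jg; apply/two_X_Gfil/Jfil_mul_two_X. Qed.

Lemma closed_sq_Gfil f : closed_sq (Jfil 0) f -> Gfil 0 f.
Proof.
move=> cf; apply: two_X_Gfil; move: cf; apply: tclosure_lspan_min.
by move=> _ [g [h [Jg Jh ->]]]; exact: (@Jfil_mul_two_X 0 0).
Qed.

End Jacobian.
End Ideals.

(** * Coordinates on a free bimodule *)

Section Coordinates.
Variables (F : fieldType) (E : algType F) (M : bimod E E).
Variables (aI : finType) (av : aI -> M) (La : aI -> seq E).
Variable st : aI -> E -> M -> E.
Local Notation FM := (ctalg M).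

(** When [M] is freely generated by the [av a], the element [st a s m] of [E] is
    the coefficient of [m] along [s (av a)] for the right action. In the last
    field, summing over [s], the tensors of [st a s (u m)] with [s] and of
    [st a s m] with [u s] are equal over [F]; testing them against balanced maps
    avoids a tensor product of [E] with itself. *)
Record free_coords : Prop := FreeCoords {
  coordD : forall a s, s \in La a -> {morph st a s : m m' / m + m'};
  coord_ract : forall a s m t, s \in La a -> st a s (ract M m t) = st a s m * t;
  coord_id : forall m,
    m = \sum_a \sum_(s <- La a) ract M (lact M s (av a)) (st a s m);
  coord_lact : forall a u m (W : zmodType) (f : E -> E -> W),
    (forall y, {morph f^~ y : x x' / x + x'}) ->
    (forall x, {morph f x : y y' / y + y'}) ->
    (forall c x y, f (c *: x) y = f x (c *: y)) ->
    \sum_(s <- La a) f (st a s (lact M u m)) s =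
    \sum_(s <- La a) f (st a s m) (u * s)
}.

Hypothesis coords : free_coords.

Lemma coord_linear a s c m m' : s \in La a ->
  st a s (c *: m + m') = c *: st a s m + st a s m'.
Proof.
move=> sL; rewrite (coordD coords sL); congr (_ + _).
have -> : c *: m = ract M m (c *: 1).
  have m0 : ract M m 0 = 0.
    by have := ract_linearr M m (-1) 0 0; rewrite !scaleN1r !addNr.
  by have := ract_linearr M m c 1 0; rewrite m0 !addr0 ract1.
by rewrite (coord_ract coords) // -scalerAr mulr1.
Qed.

(** The bimodule map that sends [av a] to the corner of [b a]. *)
Definition dev (b : aI -> FM) (m : M) : FM :=
  \sum_a \sum_(s <- La a) incl0 M s * b a * incl0 M (st a s m).

(** When [m = s a t], this is [t * g * s]: the cyclic word [m g] with the letter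
    [a] cut out. *)
Definition cofactor_at (a : aI) (m : M) (g : FM) : FM :=
  \sum_(s <- La a) incl0 M (st a s m) * g * incl0 M s.

Lemma dev_linear b : linear (dev b).
Proof.
move=> c m m'; rewrite /dev scaler_sumr -big_split; apply: eq_bigr => a _ /=.
rewrite scaler_sumr -big_split /= big_seq [RHS]big_seq; apply: eq_bigr => s sL.
by rewrite coord_linear // incl0D incl0Z mulrDr scalerAr.
Qed.

Lemma dev_lact b u m : dev b (lact M u m) = incl0 M u * dev b m.
Proof.
rewrite /dev mulr_sumr; apply: eq_bigr => a _.
rewrite (coord_lact coords a u m (f := fun x y => incl0 M y * b a * incl0 M x)).
- by rewrite mulr_sumr; apply: eq_bigr => s _; rewrite incl0M !mulrA.
- by move=> y x x'; rewrite incl0D mulrDr.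
- by move=> x y y'; rewrite incl0D !mulrDl.
- by move=> c x y; rewrite !incl0Z -scalerAr -!scalerAl.
Qed.

Lemma dev_ract b m t : dev b (ract M m t) = dev b m * incl0 M t.
Proof.
rewrite /dev mulr_suml; apply: eq_bigr => a _.
rewrite mulr_suml big_seq [RHS]big_seq; apply: eq_bigr => s sL.
by rewrite (coord_ract coords) // incl0M !mulrA.
Qed.

Lemma devB b b' m : dev (fun a => b a - b' a) m = dev b m - dev b' m.
Proof.
rewrite /dev -sumrB; apply: eq_bigr => a _; rewrite -sumrB.
by apply: eq_bigr => s _; rewrite mulrBr mulrBl.
Qed.

Lemma dev_deg k b m : (forall a, deg_ge k (b a)) -> deg_ge k (dev b m).
Proof.
move=> bk; apply: deg_ge_sum => a _; apply: deg_ge_sum => s _.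
by apply/deg_geMr/deg_geMl.
Qed.

Lemma dev_cyc b m g :
  cyc_equiv (dev b m * g) (\sum_a b a * cofactor_at a m g).
Proof.
rewrite mulr_suml; apply: cyc_equiv_sum => a _.
rewrite mulr_suml mulr_sumr; apply: cyc_equiv_sum => s _.
have := cyc_equivC (incl0 M s) (b a * incl0 M (st a s m) * g).
by rewrite !mulrA.
Qed.

Lemma cofactor_deg k a m g : deg_ge k g -> deg_ge k (cofactor_at a m g).
Proof. by move=> gk; apply: deg_ge_sum => s _; apply/deg_geMr/deg_geMl. Qed.

Lemma cofactorB a m g g' :
  cofactor_at a m (g - g') = cofactor_at a m g - cofactor_at a m g'.
Proof.
by rewrite /cofactor_at -sumrB; apply: eq_bigr => s _; rewrite mulrBr mulrBl.
Qed.

Let ev (psi : M -> E) l (m : M) (y : tpow M l) : tpow M l :=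
  lact (tpow M l) (psi m) y.

Let ev_bal a s l : s \in La a ->
  balanced (ract M) (lact (tpow M l)) (@ev (st a s) l).
Proof.
move=> sL; split=> [y|m|m t y].
- by move=> c m m'; rewrite /ev coord_linear // lact_linearl.
- by move=> c y y'; rewrite /ev lact_linearr.
- by rewrite /ev (coord_ract coords) // lactM.
Qed.

Lemma psi_ext_incl1 a s m g : s \in La a ->
  psi_ext (st a s) (incl1 m * g) = incl0 M (st a s m) * g.
Proof.
move=> sL; apply: dprodP => l; rewrite incl1E incl0ME.
exact: tlift_tens (ev_bal l sL) m (g l).
Qed.

Lemma psi_ext_eq0 a s f l : s \in La a -> f l.+1 = 0 -> psi_ext (st a s) f l = 0.
Proof. by move=> sL f0; rewrite /psi_ext f0; exact: tlift0 (ev_bal l sL). Qed.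

Lemma psi_extB a s f g : s \in La a ->
  psi_ext (st a s) (f - g) = psi_ext (st a s) f - psi_ext (st a s) g.
Proof.
move=> sL; apply: dprodP => l; rewrite !dprodDE !dprodNE.
have := tlift_linear (ev_bal l sL) (-1) (g l.+1) (f l.+1).
rewrite !scaleN1r => e; rewrite [RHS]addrC; apply: etrans e.
by rewrite /psi_ext dprodDE dprodNE addrC.
Qed.

(** This sends [m g], with [m] of degree one, to [cofactor_at a m g]; the
    element X_{a^*}(P) is [strip a (delta P)]. *)
Definition strip (a : aI) (f : FM) : FM :=
  \sum_(s <- La a) psi_ext (st a s) f * incl0 M s.

Lemma stripB a f g : strip a (f - g) = strip a f - strip a g.
Proof.
rewrite /strip -sumrB big_seq [RHS]big_seq; apply: eq_bigr => s sL.
by rewrite psi_extB // mulrBl.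
Qed.

Lemma strip0 a : strip a 0 = 0.
Proof. by have := stripB a 0 0; rewrite !subrr. Qed.

Lemma stripD a f g : strip a (f + g) = strip a f + strip a g.
Proof.
have -> : f + g = f - (0 - g) by rewrite sub0r opprK.
by rewrite !stripB strip0 sub0r opprK.
Qed.

Lemma strip_sum a (I : Type) (r : seq I) (Q : pred I) (u : I -> FM) :
  strip a (\sum_(j <- r | Q j) u j) = \sum_(j <- r | Q j) strip a (u j).
Proof. by apply: (big_morph _ (stripD a)); exact: strip0. Qed.

Lemma strip_eq0 a f l : f l.+1 = 0 -> strip a f l = 0.
Proof.
move=> f0; rewrite /strip dprod_sumE big_seq big1 // => s sL.
rewrite ctalgME big1 // => -[i /= il] _; move: il; rewrite ltnS leq_eqVlt.
case/orP => [/eqP ->|il]; first by rewrite psi_ext_eq0 // tmul0l.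
by apply: tmul_eq0; [exact: ltnW|move: il; rewrite -subn_gt0; case: (l - i)%N].
Qed.

Lemma strip_incl1 a m g : strip a (incl1 m * g) = cofactor_at a m g.
Proof.
rewrite /strip /cofactor_at big_seq [RHS]big_seq; apply: eq_bigr => s sL.
by rewrite psi_ext_incl1.
Qed.

Lemma strip_incl0 a s : strip a (incl0 M s) = 0.
Proof. by apply: dprodP => l; apply: strip_eq0. Qed.

Lemma cofactor_lact a u m g :
  cofactor_at a (lact M u m) g = cofactor_at a m (g * incl0 M u).
Proof.
rewrite /cofactor_at.
rewrite (coord_lact coords a u m (f := fun x y => incl0 M x * g * incl0 M y)).
- by apply: eq_bigr => s _; rewrite incl0M !mulrA.
- by move=> y x x'; rewrite incl0D !mulrDl.
- by move=> x y y'; rewrite incl0D !mulrDr.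
- by move=> c x y; rewrite !incl0Z -scalerAr -!scalerAl.
Qed.

(** Cutting a letter out of a cyclic word does not depend on where the word
    starts, as long as the rotation only moves elements of [E]. *)
Lemma strip_incl0C a u f : strip a (incl0 M u * f) = strip a (f * incl0 M u).
Proof.
have hC i (x : tpow M i) :
    strip a (incl0 M u * hinj x) = strip a (hinj x * incl0 M u).
  elim/tpow_ind: i / x => [i|i x y IHx IHy|s|i m y IHy].
  - by rewrite hinj_0 mulr0 mul0r.
  - by rewrite hinjD mulrDr mulrDl !stripD IHx IHy.
  - by rewrite hinj0 -!incl0M !strip_incl0.
  - by rewrite hinjS mulrA -incl1_lact -mulrA !strip_incl1 cofactor_lact.
apply/eqP; rewrite -subr_eq0 -stripB; apply/eqP/deg_ge_eq0 => n l ln.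
pose h := \sum_(i < n.+1) hinj (f i).
have fh : deg_ge n.+1 (f - h) := @hinj_trunc _ _ _ f n.+1.
have -> : incl0 M u * f - f * incl0 M u =
    (incl0 M u * (f - h) - (f - h) * incl0 M u) + (incl0 M u * h - h * incl0 M u).
  by rewrite mulrBr mulrBl opprB [RHS]addrAC !addrA !subrK.
rewrite stripD dprodDE [strip a (incl0 M u * h - _)]stripB mulr_sumr mulr_suml !strip_sum.
rewrite (eq_bigr _ (fun (i : 'I_n.+1) _ => hC i (f i))) subrr addr0.
by apply: strip_eq0; apply: (@deg_geB _ _ _ n.+1) => //;
  [exact: deg_geMl|exact: deg_geMr].
Qed.

Definition perturb (b : aI -> FM) (m : M) : FM := incl1 m + dev b m.

Lemma perturb_bimod b : (forall a, deg_ge 1 (b a)) -> bimod_map (perturb b).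
Proof.
move=> b1; split=> [c m m'|s m|m s|m]; rewrite /perturb.
- by rewrite incl1_linear dev_linear scalerDr addrACA.
- by rewrite incl1_lact dev_lact mulrDr.
- by rewrite incl1_ract dev_ract mulrDl.
- by apply: deg_geD; [exact: incl1_deg|exact: dev_deg].
Qed.

Lemma perturbB b b' m : perturb b' m - perturb b m = dev (fun a => b' a - b a) m.
Proof. by rewrite devB /perturb opprD addrACA subrr add0r. Qed.

Lemma perturb0 m : perturb (fun=> 0) m = incl1 m.
Proof.
rewrite /perturb /dev big1 ?addr0 // => a _; rewrite big1 // => s _.
by rewrite mulr0 mul0r.
Qed.

Definition homogeneous d (f : FM) := forall k, k != d -> f k = 0.

Lemma homogeneousM i j (f g : FM) :
  homogeneous i f -> homogeneous j g -> homogeneous (i + j)%N (f * g).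
Proof.
move=> hf hg k kij; rewrite ctalgME big1 // => s _.
have [si|si] := eqVneq (s : nat) i; last by rewrite hf // tmul0l.
apply: tmul_eq0; first by rewrite -ltnS.
have sk : (s <= k)%N by rewrite -ltnS.
apply: hg; apply: contra_neq kij => e; by rewrite -e -si subnKC.
Qed.

Lemma homogeneous_hinj i (x : tpow M i) : homogeneous i (hinj x).
Proof. by move=> k; exact: hinj_ne. Qed.

Lemma cofactor_homogeneous d a m g :
  homogeneous d g -> homogeneous d (cofactor_at a m g).
Proof.
move=> gd k kd; rewrite /cofactor_at dprod_sumE big1 // => s _.
have h t : homogeneous 0 (incl0 M t) by case.
by have := homogeneousM (homogeneousM (h (st a s m)) gd) (h s); rewrite addn0; apply.
Qed.

(** * Cyclic derivatives *)

(** [Z a f g] differentiates the cyclic word [f g] with respect to the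
    occurrences of [a] in [f]. These axioms determine [Z], so nothing else
    has to be known about the way in which it is obtained from [Delta]. *)
Record cyclic_derivation (Z : aI -> talg M -> talg M -> FM) : Prop :=
  CyclicDerivation {
  cycderD : forall a g, {morph Z a ^~ g : x y / x + y};
  cycder_incl0 : forall a s g, Z a (tincl0 M s) g = 0;
  cycder_incl1 : forall a m g, Z a (tincl1 m) g = cofactor_at a m g;
  cycderM : forall a x y g, Z a (x * y) g = Z a x (y * g) + Z a y (g * x)
}.

Section CycDer.
Variable Z : aI -> talg M -> talg M -> FM.
Hypothesis HZ : cyclic_derivation Z.

Lemma cycder0 a g : Z a 0 g = 0.
Proof. by apply: (addrI (Z a 0 g)); rewrite -(cycderD HZ) !addr0. Qed.

Definition tinj i (x : tpow M i) : talg M := homog (hinj x) i.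

Lemma tinjE i (x : tpow M i) : tinj x = hinj x :> FM.
Proof. by rewrite homogE hinj_id. Qed.

Lemma tinjD i (x y : tpow M i) : tinj (x + y) = tinj x + tinj y.
Proof. by apply: talg_inj; rewrite talgD !tinjE hinjD. Qed.

Lemma tinj_0 i : tinj (0 : tpow M i) = 0.
Proof. by apply: talg_inj; rewrite tinjE hinj_0. Qed.

Lemma tinjS i m (y : tpow M i) :
  tinj (tens m y : tpow M i.+1) = tincl1 m * tinj y.
Proof. by apply: talg_inj; rewrite talgM !tinjE hinjS. Qed.

Lemma tinj0 (s : tpow M 0) : tinj s = tincl0 M s.
Proof. by apply: talg_inj; rewrite !tinjE hinj0. Qed.

Lemma homog_tinj (f : FM) i : homog f i = tinj (f i).
Proof. by apply: talg_inj; rewrite tinjE homogE. Qed.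

Lemma cycder_homogeneous a i (x : tpow M i) d (g : talg M) k :
  homogeneous d g -> k.+1 != (i + d)%N -> Z a (tinj x) g k = 0.
Proof.
elim/tpow_ind: i / x d g => [i|i x y IHx IHy|s|i m y IHy] d g gd kd.
- by rewrite tinj_0 cycder0.
- by rewrite tinjD (cycderD HZ) dprodDE (IHx _ _ gd kd) (IHy _ _ gd kd) addr0.
- by rewrite tinj0 (cycder_incl0 HZ).
rewrite tinjS (cycderM HZ) (cycder_incl1 HZ) dprodDE (IHy d.+1); first last.
- by rewrite addnS.
- rewrite talgM -addn1; apply: homogeneousM => //.
  have := @homogeneous_hinj 1 (tens m (1 : E)).
  by rewrite hinjS hinj0 incl0_1 mulr1.
rewrite addr0; apply: (@cofactor_homogeneous (i + d)%N); last by rewrite addSn eqSS in kd.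
by rewrite talgM; apply: homogeneousM => //; rewrite tinjE; exact: homogeneous_hinj.
Qed.

End CycDer.

(** * Deformations of a potential *)

Section Potential.
Variables (X : aI -> FM) (Z : aI -> talg M -> talg M -> FM) (P : FM).
Local Notation J := (Jfil X).
Local Notation phi b := (ext (perturb b)).
Hypothesis X2 : forall a, deg_ge 2 (X a).

Let JS k : subspace (J k) := @Jfil_subspace F E M aI X k.

Lemma J_deg k f : J k f -> deg_ge k.+2 f.
Proof. by move=> Jf; have := Jfil_deg X2 Jf; rewrite addn2. Qed.

Lemma dev_J k b m : (forall a, J k (b a)) -> J k (dev b m).
Proof.
move=> Jb; apply: (subspace_sum (JS k)) => a _.
apply: (subspace_sum (JS k)) => s _; rewrite -[k]addn0.
by apply: JfilMr => //; rewrite -[k]addn0; apply: JfilMl.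
Qed.

Lemma cofactor_J k a m g : J k g -> J k (cofactor_at a m g).
Proof.
move=> Jg; apply: (subspace_sum (JS k)) => s _; rewrite -[k]addn0.
by apply: JfilMr => //; rewrite -[k]addn0; apply: JfilMl.
Qed.

Lemma J0_bimod b : (forall a, J 0 (b a)) -> bimod_map (perturb b).
Proof.
by move=> Jb; apply: perturb_bimod => a; apply: (deg_geW _ (J_deg (Jb a))).
Qed.

(** Changing one letter of a word of length [i] leaves [i - 1] letters around
    the difference. *)
Lemma hext_sub_J b i (x : tpow M i) : (forall a, J 0 (b a)) ->
  J i.-1 (hext (perturb b) x - hinj x).
Proof.
move=> Jb; have bm := J0_bimod Jb.
elim/tpow_ind: i / x => [i|i x y IHx IHy|s|i m y IHy].
- by rewrite (hext0 bm) hinj_0 subrr; exact: subspace0 (JS _).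
- by rewrite (hextD bm) hinjD opprD addrACA; apply: (subspaceD (JS _)).
- by rewrite hinj0 subrr; exact: subspace0 (JS _).
have -> : hext (perturb b) (tens m y : tpow M i.+1) - hinj (tens m y : tpow M i.+1) =
    dev b m * hext (perturb b) y + incl1 m * (hext (perturb b) y - hinj y).
  by rewrite (hextS bm) hinjS /perturb mulrDl mulrBr addrAC addrC.
apply: (subspaceD (JS _)).
  have := JfilMr (dev_J m Jb) (hext_deg bm y); exact.
apply: (JfilW (k := i.-1 + 1)); first by rewrite addn1; exact: leqSpred.
by apply: JfilMl => //; exact: incl1_deg.
Qed.

Lemma ext_sub_J b f : (forall a, J 0 (b a)) -> J 0 (phi b f - f).
Proof.
move=> Jb; have bm := J0_bimod Jb; apply: Jfil_closed => n.
exists (\sum_(i < n) (hext (perturb b) (f i) - hinj (f i))).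
  by apply: (subspace_sum (JS _)) => i _; apply: JfilW (hext_sub_J _ Jb).
rewrite sumrB opprD addrACA -opprD.
by apply: deg_geB; [exact: ext_trunc|exact: hinj_trunc].
Qed.

Hypothesis HZ : cyclic_derivation Z.

Let leq_pred_addn j k : ((j + k).-1 <= j.-1 + k)%N.
Proof. by case: j => //; exact: leq_pred. Qed.

(** Telescoping [hext (perturb b') x - hext (perturb b) x] along the word [x]
    and rotating each summand moves the new letters to the left of the old
    ones. The second factor [g] collects the letters that were already
    transported; the same recursion with untransported letters [g'] computes
    [Z a (tinj x) g'], so the error terms only come from [g - g'] and from the
    images of the remaining letters, and their size is counted by the letters
    around them. *)
Lemma twisted_cyclic_derivative b b' i (x : tpow M i) d (g : FM) (g' : talg M) :
  (forall a, J 0 (b a)) -> (forall a, J 0 (b' a)) ->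
  deg_ge d g -> deg_ge d (g' : FM) -> J d.-1 (g - talg_val g') ->
  exists2 Y : aI -> FM,
    cyc_equiv ((hext (perturb b') x - hext (perturb b) x) * g)
              (\sum_a (b' a - b a) * Y a) &
    forall a, deg_ge (i.-1 + d) (Y a) /\
              J (i.-1 + d).-1 (Y a - Z a (tinj x) g').
Proof.
move=> Jb Jb'; have bm := J0_bimod Jb; have bm' := J0_bimod Jb'.
elim/tpow_ind: i / x d g g' => [i|i x y IHx IHy|s|i m y IHy] d g g' gd gd' Jg.
- exists (fun=> 0).
    rewrite (hext0 bm) (hext0 bm') subrr mul0r big1 => [|a _].
      exact: cyc_equiv_refl.
    by rewrite mulr0.
  move=> a; split=> //; rewrite tinj_0 (cycder0 HZ) subrr.
  exact: subspace0 (JS _).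
- have [Y Yc YZ] := IHx _ _ _ gd gd' Jg; have [Y' Yc' YZ'] := IHy _ _ _ gd gd' Jg.
  exists (fun a => Y a + Y' a).
    rewrite (hextD bm) (hextD bm') opprD addrACA mulrDl.
    under eq_bigr do rewrite mulrDr.
    by rewrite big_split; apply: cyc_equivD.
  move=> a; have [[h1 h2] [h1' h2']] := (YZ a, YZ' a).
  split; first exact: deg_geD.
  by rewrite tinjD (cycderD HZ) opprD addrACA; apply: (subspaceD (JS _)).
- exists (fun=> 0).
    rewrite subrr mul0r big1 => [|a _]; first exact: cyc_equiv_refl.
    by rewrite mulr0.
  by move=> a; split=> //; rewrite tinj0 (cycder_incl0 HZ) subrr; exact: subspace0 (JS _).
pose h := hext (perturb b) y * g; pose k := g * perturb b' m.
have kd : deg_ge d.+1 k by rewrite -addn1; apply: deg_geM => //; case: bm'.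
have kd' : deg_ge d.+1 (talg_val (g' * tincl1 m)).
  by rewrite -addn1; apply: deg_geM => //; exact: incl1_deg.
have Jk : J d.+1.-1 (k - talg_val (g' * tincl1 m)).
  have -> : k - talg_val (g' * tincl1 m) =
      (g - talg_val g') * perturb b' m + talg_val g' * dev b' m.
    rewrite mulrBl; have -> : talg_val g' * perturb b' m =
      talg_val g' * incl1 m + talg_val g' * dev b' m by rewrite -mulrDr.
    by rewrite opprD addrA subrK.
  apply: (subspaceD (JS _)).
    apply: (JfilW (k := d.-1 + 1)); first by rewrite addn1; exact: leqSpred.
    by apply: JfilMr => //; case: bm'.
  by rewrite -[d.+1.-1]add0n; apply: JfilMl => //; apply: dev_J.
have [Y Yc YZ] := IHy _ _ _ kd kd' Jk.
exists (fun a => cofactor_at a m h + Y a).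
  have -> : (hext (perturb b') (tens m y : tpow M i.+1) -
             hext (perturb b) (tens m y : tpow M i.+1)) * g =
      dev (fun a => b' a - b a) m * h +
      perturb b' m * ((hext (perturb b') y - hext (perturb b) y) * g).
    rewrite -perturbB (hextS bm) (hextS bm') /h !mulrBl !mulrBr !mulrA.
    by rewrite [RHS]addrC addrA subrK.
  under eq_bigr do rewrite mulrDr.
  rewrite big_split; apply: cyc_equivD; first exact: dev_cyc.
  by apply: cyc_equivT Yc; rewrite /k [X in cyc_equiv _ X]mulrA; exact: cyc_equivC.
move=> a; have [Yd YJ] := YZ a; split.
  apply: deg_geD; first by apply/cofactor_deg/deg_geM => //; exact: hext_deg.
  apply: deg_geW Yd; rewrite addnS -addSn leq_add2r; exact: leqSpred.
rewrite tinjS (cycderM HZ) (cycder_incl1 HZ) opprD addrACA -cofactorB.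
apply: (subspaceD (JS _)).
  apply: cofactor_J.
  have -> : h - talg_val (tinj y * g') =
      (hext (perturb b) y - hinj y) * g + hinj y * (g - talg_val g').
    by rewrite talgM tinjE mulrBl mulrBr addrA subrK.
  apply: (subspaceD (JS _)).
    apply: (JfilW (k := i.-1 + d)); last by apply: JfilMr => //; exact: hext_sub_J.
    exact: leq_pred_addn.
  apply: (JfilW (k := d.-1 + i)); last by apply: JfilMl => //; exact: hinj_deg.
  by rewrite [(_ + d)%N]addnC; exact: leq_pred_addn.
by apply: JfilW YJ; rewrite addnS; exact: leq_pred_addn.
Qed.

Hypotheses (P3 : deg_ge 3 P)
  (XZ : forall a n, deg_ge n (X a - \sum_(i < n.+1) Z a (homog P i) 1)).

(** The bound J_1 is where the hypothesis that [P] has no terms of degree less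
    than 3 enters: removing a letter from a word of length [i] leaves [i - 1]
    letters, of which one is changed and at least one more remains. *)
Lemma phi_sub_cyc b b' : (forall a, J 0 (b a)) -> (forall a, J 0 (b' a)) ->
  exists2 Y : aI -> FM,
    cyc_equiv (phi b' P - phi b P) (\sum_a (b' a - b a) * Y a) &
    forall a, J 1 (Y a - X a).
Proof.
move=> Jb Jb'; have bm := J0_bimod Jb; have bm' := J0_bimod Jb'.
have hY i : exists Y : aI -> FM,
    cyc_equiv (hext (perturb b') (P i) - hext (perturb b) (P i))
              (\sum_a (b' a - b a) * Y a) /\
    forall a, deg_ge i.-1 (Y a) /\ J 1 (Y a - Z a (homog P i) 1).
  have [i3|i3] := ltnP i 3.
    exists (fun=> 0); split=> [|a].
      rewrite P3 // (hext0 bm) (hext0 bm') subrr big1 => [|a _].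
        exact: cyc_equiv_refl.
      by rewrite mulr0.
    split=> //; rewrite homog_tinj P3 // tinj_0 (cycder0 HZ) subrr.
    exact: subspace0 (JS _).
  have [|Y Yc YZ] := @twisted_cyclic_derivative b b' i (P i) 0 1 1 Jb Jb'
     (deg_ge0 _) (deg_ge0 _).
    by rewrite subrr; exact: subspace0 (JS _).
  exists Y; split=> [|a]; first by rewrite mulr1 in Yc.
  have [Yd YJ] := YZ a; rewrite addn0 in Yd YJ; split=> //.
  rewrite homog_tinj.
  by apply: JfilW YJ; case: i i3 {Y Yc YZ Yd} => [|[|[|i]]].
have [Y YP] := choice hY.
pose S a n := \sum_(i < n.+1) Y i a.
have SP a n : deg_ge n (diag_lim (S a) - S a n).
  apply: diag_limP => {}n; rewrite /S big_ord_recr /= addrAC subrr add0r.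
  by have [_ /(_ a)[]] := YP n.+1.
exists (fun a => diag_lim (S a)) => [|a].
  apply: cyc_equiv_approx => n.
  exists (\sum_(i < n.+1) (hext (perturb b') (P i) - hext (perturb b) (P i))),
         (\sum_a (b' a - b a) * S a n); split.
  - rewrite sumrB opprD addrACA -opprD; apply: (@deg_geW _ _ _ _ n.+1) => //.
    by apply: deg_geB; exact: ext_trunc.
  - rewrite -sumrB; apply: deg_ge_sum => a _; rewrite -mulrBr.
    by apply: deg_geMl; apply: SP.
  rewrite (eq_bigr (fun a => \sum_(i < n.+1) (b' a - b a) * Y i a)); last first.
    by move=> a _; rewrite mulr_sumr.
  rewrite exchange_big; apply: cyc_equiv_sum => i _; by have [] := YP i.
apply: Jfil_closed => n; exists (S a n - \sum_(i < n.+1) Z a (homog P i) 1).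
  rewrite -sumrB; apply: (subspace_sum (JS _)) => i _.
  by have [_ /(_ a)[]] := YP i.
by rewrite opprD addrACA -opprD; apply: deg_geB.
Qed.

Hypotheses (fE : fin_span E) (fM : fin_span M).

(** The correction is the family of coefficients itself; the new error is a sum
    of products of elements of J_n and J_1. *)
Lemma deformation_step n b Q : (forall a, J 0 (b a)) -> Gfil X n (Q - phi b P) ->
  exists2 b' : aI -> FM, forall a, J n (b' a - b a) &
    Gfil X n.+1 (Q - phi b' P).
Proof.
move=> Jb [C JC hC]; exists (fun a => b a + C a) => [a|].
  by rewrite addrAC subrr add0r.
have Jb' a : J 0 (b a + C a).
  by apply: (subspaceD (JS _)) => //; apply: JfilW (JC a).
have [Y Yc YJ] := phi_sub_cyc Jb Jb'.
apply: (@Gfil_cyc _ _ _ _ _ _ _ (- \sum_a C a * (Y a - X a))).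
  have -> : Q - phi (fun a => b a + C a) P =
     (Q - phi b P) - (phi (fun a => b a + C a) P - phi b P).
    by rewrite opprB addrA subrK.
  have -> : - \sum_a C a * (Y a - X a) =
     \sum_a C a * X a - \sum_a (b a + C a - b a) * Y a.
    rewrite -sumrB -sumrN; apply: eq_bigr => a _.
    by rewrite [b a + _]addrC addrK mulrBr opprB.
  exact: cyc_equivB.
apply: (subspaceN (@Gfil_subspace _ _ _ _ _ _)).
apply: (subspace_sum (@Gfil_subspace _ _ _ _ _ _)) => a _.
by rewrite -addn1; apply: Jfil_mul_Gfil.
Qed.

Lemma ext_sub_deg n (bt bt' : M -> FM) f : bimod_map bt -> bimod_map bt' ->
  (forall m, deg_ge n (bt m - bt' m)) -> deg_ge n (ext bt f - ext bt' f).
Proof.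
move=> bm bm' btn.
have tn i (x : tpow M i) : deg_ge n (hext bt x - hext bt' x).
  elim/tpow_ind: i / x => [i|i x y IHx IHy|s|i m y IHy].
  - by rewrite (hext0 bm) (hext0 bm') subrr.
  - by rewrite (hextD bm) (hextD bm') opprD addrACA; apply: deg_geD.
  - by rewrite subrr.
  have -> : hext bt (tens m y : tpow M i.+1) - hext bt' (tens m y : tpow M i.+1) =
      (bt m - bt' m) * hext bt y + bt' m * (hext bt y - hext bt' y).
    by rewrite (hextS bm) (hextS bm') mulrBl mulrBr addrA subrK.
  by apply: deg_geD; [exact: deg_geMr|exact: deg_geMl].
move=> l ln; rewrite dprodDE dprodNE /ext -sumrB big1 // => i _.
by have := tn i (f i) l ln; rewrite dprodDE dprodNE.
Qed.

Lemma ext_perturb0 f : phi (fun=> 0) f = f.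
Proof.
have bm : bimod_map (perturb (fun=> 0)) by apply: perturb_bimod.
apply/eqP; rewrite -subr_eq0; apply/eqP/deg_ge_eq0 => n.
have e i (x : tpow M i) : hext (perturb (fun=> 0)) x = hinj x.
  elim/tpow_ind: i / x => [i|i x y IHx IHy|s|i m y IHy].
  - by rewrite (hext0 bm) hinj_0.
  - by rewrite (hextD bm) hinjD IHx IHy.
  - by rewrite hinj0.
  - by rewrite (hextS bm) hinjS perturb0 IHy.
have -> : phi (fun=> 0) f - f = (phi (fun=> 0) f - \sum_(i < n) hinj (f i)) -
    (f - \sum_(i < n) hinj (f i)).
  by rewrite opprB addrA subrK.
apply: deg_geB; last exact: hinj_trunc.
by under eq_bigr do rewrite -e; exact: ext_trunc.
Qed.

(** The correction made at step [n] lies in J_n, hence in degrees larger than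
    [n]; so the families converge, and J_0 is closed. *)
Lemma cyc_equiv_deformation P' : closed_sq (J 0) (P' - P) ->
  exists2 b : aI -> FM, forall a, J 0 (b a) & cyc_equiv (phi b P) P'.
Proof.
move=> PP'.
have hnx (t : nat * (aI -> FM)) : exists b' : aI -> FM,
    (forall a, J 0 (t.2 a)) -> Gfil X t.1 (P' - phi t.2 P) ->
    (forall a, J t.1 (b' a - t.2 a)) /\ Gfil X t.1.+1 (P' - phi b' P).
  case: t => n b /=.
  have [[Jb Gb]|nh] := EM ((forall a, J 0 (b a)) /\ Gfil X n (P' - phi b P)).
    by have [b' Jb' Gb'] := deformation_step Jb Gb; exists b'.
  by exists b => Jb Gb; case: nh.
have [nx nxP] := choice hnx.
pose u := fix u n : aI -> FM := if n is n'.+1 then nx (n', u n') else fun=> 0.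
have uP n : (forall a, J 0 (u n a)) /\ Gfil X n (P' - phi (u n) P).
  elim: n => [|n [IHJ IHG]].
    split=> [a|]; first exact: subspace0 (JS _).
    by rewrite ext_perturb0; apply: closed_sq_Gfil.
  have [Jn Gn] := nxP (n, u n) IHJ IHG; split=> // a.
  rewrite -[u n.+1 a](subrK (u n a)); apply: (subspaceD (JS _)) => //.
  exact: JfilW (Jn a).
have uJ n a : J n (u n.+1 a - u n a).
  by have [IHJ IHG] := uP n; have [Jn _] := nxP (n, u n) IHJ IHG; apply: Jn.
pose b a := diag_lim (u^~ a).
have bP a n : deg_ge n (b a - u n a).
  by apply: diag_limP => {}n; apply: (deg_geW _ (J_deg (uJ n a))); rewrite leqW.
have Jb a : J 0 (b a).
  by apply: Jfil_closed => n; exists (u n a) => //; have [] := uP n.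
exists b => //; apply: cyc_equiv_approx => n.
have [Ju [C JC PC]] := uP n.
exists (phi (u n) P + \sum_a C a * X a), P'; split; last 2 first.
- by rewrite subrr.
- apply: cyc_equivS; rewrite -[P'](subrK (phi (u n) P)) addrC.
  by apply: cyc_equivD => //; exact: cyc_equiv_refl.
rewrite opprD addrA; apply: deg_geB.
  apply: ext_sub_deg; [exact: J0_bimod|exact: J0_bimod|move=> m].
  by rewrite perturbB; apply: dev_deg.
apply: deg_ge_sum => a _; apply: deg_geMr.
by apply: (deg_geW _ (J_deg (JC a))); rewrite leqW.
Qed.

End Potential.
End Coordinates.

Lemma morph_sub (U W : zmodType) (k : U -> W) :
  {morph k : x y / x + y} -> {morph k : x y / x - y}.
Proof. by move=> kD x y; apply: (addIr (k y)); rewrite -kD !subrK. Qed.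

(** * The cyclic derivation attached to Delta *)

Section Idempotents.
Variables (F : fieldType) (n : nat) (E_ : 'I_n.+1 -> falgType F).
Local Notation E := (prodalg E_).
Local Notation e := (idem E_).

Lemma idem_central i (x : E) : e i * x = x * e i.
Proof.
apply: dprodP => k; rewrite -[LHS]/((i == k)%:R * x k) -[RHS]/(x k * (i == k)%:R).
by case: eqP; rewrite ?mul1r ?mulr1 ?mul0r ?mulr0.
Qed.

Lemma idemM i j : e i * e j = if i == j then e i else 0.
Proof.
apply: dprodP => k; rewrite -[LHS]/((i == k)%:R * (j == k)%:R).
have [<-|ij] := eqVneq i j; first by rewrite /idem; case: eqP; rewrite ?mul1r ?mul0r.
by case: eqP => [<-|]; rewrite ?mul0r // eq_sym (negPf ij) mulr0.
Qed.

Lemma sum_idem : \sum_i e i = 1.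
Proof.
apply: dprodP => k; apply: etrans (dprod_sumE _ _ _ k) _.
rewrite (bigD1 k) //= big1 ?addr0 => [|i ik]; first by rewrite /idem eqxx.
by rewrite /idem (negPf ik).
Qed.

Lemma idem_Zsub i : Zsub (e i).
Proof.
exists (fun j => (j == i)%:R); rewrite (bigD1 i) //= eqxx scale1r big1 ?addr0 //.
by move=> j /negPf ->; rewrite scale0r.
Qed.

Lemma Zsub_idem (z : E) : Zsub z -> exists c : 'I_n.+1 -> F,
  forall i, e i * z = c i *: e i /\ z * e i = c i *: e i.
Proof.
move=> [c zE]; exists c => i; suff h : e i * z = c i *: e i.
  by rewrite -idem_central h.
rewrite zE mulr_sumr (bigD1 i) //= -scalerAr idemM eqxx big1 ?addr0 // => j ji.
by rewrite -scalerAr idemM eq_sym (negPf ji) scaler0.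
Qed.

End Idempotents.

Section CyclicDerivation.
Variables (F : fieldType) (n : nat) (E_ : 'I_n.+1 -> falgType F).
Local Notation E := (prodalg E_).
Local Notation Z := (Ztype E_).
Local Notation e := (idem E_).
Variables (V : vectType F) (M : bimod_on E E V) (M0 : {vspace V}).
Local Notation BM := (Bimod M).
Local Notation FM := (ctalg BM).
Local Notation T := (talg BM).
Local Notation i0 := (tincl0 BM).

Variables (D : T -> TZT M) (HD : is_Delta M0 D).

Lemma tincl0M (s t : E) : i0 (s * t) = i0 s * i0 t.
Proof. by apply: talg_inj; exact: incl0M. Qed.

Lemma tincl0Z c (s : E) : i0 (c *: s) = c *: i0 s.
Proof. by apply: talg_inj; exact: incl0Z. Qed.

Lemma TZT_ract_bal (t : T) : balanced
  (fun (x : T) (z : Z) => x * i0 (sval z)) (fun (z : Z) (y : T) => i0 (sval z) * y)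
  (fun x y => tens x (y * t) : TZT M).
Proof.
split=> [y|x|x z y].
- by move=> c x x'; rewrite tensDl tensZl.
- by move=> c y y'; rewrite mulrDl -scalerAl tensDr tensZr.
- by rewrite tens_bal mulrA.
Qed.

Lemma TZT_lact_bal (t : T) : balanced
  (fun (x : T) (z : Z) => x * i0 (sval z)) (fun (z : Z) (y : T) => i0 (sval z) * y)
  (fun x y => tens (t * x) y : TZT M).
Proof.
split=> [y|x|x z y].
- by move=> c x x'; rewrite mulrDr -scalerAr tensDl tensZl.
- by move=> c y y'; rewrite tensDr tensZr.
- by rewrite mulrA tens_bal.
Qed.

Lemma u_map_bal : balanced
  (fun (x : T) (z : Z) => x * i0 (sval z)) (fun (z : Z) (y : T) => i0 (sval z) * y)
  (fun x y => \sum_i i0 (e i) * y * x * i0 (e i)).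
Proof.
split=> [y|x|x [z Hz] y /=].
- move=> c x x'; rewrite scaler_sumr -big_split; apply: eq_bigr => i _ /=.
  by rewrite mulrDr mulrDl -scalerAr -scalerAl.
- move=> c y y'; rewrite scaler_sumr -big_split; apply: eq_bigr => i _ /=.
  by rewrite mulrDr !mulrDl -scalerAr -!scalerAl.
have [c cP] := Zsub_idem Hz; apply: eq_bigr => i _; have [cl cr] := cP i.
rewrite -!mulrA -tincl0M cr tincl0Z !mulrA -tincl0M cl tincl0Z.
by rewrite -!scalerAr -!scalerAl.
Qed.

Lemma hT_D f f' g : hT D (f + f') g = hT D f g + hT D f' g.
Proof.
rewrite /hT /u_map /TZT_ract; have [Dlin _ _ _] := HD.
have -> : D (f + f') = D f + D f' by have := Dlin 1 f f'; rewrite !scale1r.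
by rewrite (tliftD (TZT_ract_bal g)) (tliftD u_map_bal).
Qed.

(** The derivation rule for [Delta], with the right factor moved
    around the cyclic word by [u_map]. *)
Lemma hT_M x y g : hT D (x * y) g = hT D x (y * g) + hT D y (g * x).
Proof.
rewrite /hT; have [_ -> _ _] := HD.
have -> w w' : TZT_ract (w + w') g = TZT_ract w g + TZT_ract w' g.
  exact: tliftD (TZT_ract_bal g) w w'.
have uD w w' : u_map (w + w' : TZT M) = u_map w + u_map w'.
  exact: tliftD u_map_bal w w'.
have uE a b : u_map (tens a b : TZT M) = \sum_i i0 (e i) * b * a * i0 (e i).
  exact: tlift_tens u_map_bal a b.
have rE a b t : TZT_ract (tens a b : TZT M) t = tens a (b * t).
  exact: tlift_tens (TZT_ract_bal t) a b.
have lE a b t : TZT_lact t (tens a b : TZT M) = tens (t * a) b.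
  exact: tlift_tens (TZT_lact_bal t) a b.
have rD t w w' : TZT_ract (w + w' : TZT M) t = TZT_ract w t + TZT_ract w' t.
  exact: tliftD (TZT_ract_bal t) w w'.
have lD t w w' : TZT_lact t (w + w' : TZT M) = TZT_lact t w + TZT_lact t w'.
  exact: tliftD (TZT_lact_bal t) w w'.
have r0 t : TZT_ract (0 : TZT M) t = 0 by exact: tlift0 (TZT_ract_bal t).
have l0 t : TZT_lact t (0 : TZT M) = 0 by exact: tlift0 (TZT_lact_bal t).
rewrite uD; congr (_ + _); move: (D _) => w.
  congr (u_map _); elim/tensor_ind: w => [|a b|w w' IHw IHw'].
  - by rewrite !r0.
  - by rewrite !rE mulrA.
  - by rewrite !rD IHw IHw'.
elim/tensor_ind: w => [|a b|w w' IHw IHw'].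
- by rewrite l0 !r0.
- by rewrite lE !rE !uE; apply: eq_bigr => i _; rewrite !mulrA.
- by rewrite lD !rD !uD IHw IHw'.
Qed.

Lemma hT_incl0 s g :
  hT D (i0 s) g = \sum_i i0 (e i) * (i0 s * g - g * i0 s) * i0 (e i).
Proof.
rewrite /hT; have [_ _ -> _] := HD.
have -> : TZT_ract (tens 1 (i0 s) - tens (i0 s) 1 : TZT M) g =
    tens 1 (i0 s * g) - tens (i0 s) g.
  rewrite /TZT_ract (morph_sub (tliftD (TZT_ract_bal g))).
  by rewrite !(tlift_tens (TZT_ract_bal g)) mul1r.
rewrite /u_map (morph_sub (tliftD u_map_bal)) !(tlift_tens u_map_bal).
rewrite -sumrB; apply: eq_bigr => i _.
by rewrite mulr1 mulrBr mulrBl !mulrA.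
Qed.

Lemma hT_incl1 m g : m \in M0 ->
  hT D (tincl1 (m : BM)) g = \sum_i i0 (e i) * (tincl1 (m : BM) * g) * i0 (e i).
Proof.
move=> mM; rewrite /hT; have [_ _ _ -> //] := HD.
rewrite /TZT_ract (tlift_tens (TZT_ract_bal g)) /u_map (tlift_tens u_map_bal).
by apply: eq_bigr => i _; rewrite mulr1.
Qed.

Variables (aI : finType) (av : aI -> BM) (La : aI -> seq E).
Variable st : aI -> E -> BM -> E.
Hypotheses (coords : free_coords av La st) (avM0 : forall a, (av a : V) \in M0).
Local Notation strip := (strip La st).

Definition cyc_der (a : aI) (f g : T) : FM := strip a (hT D f g).

(** The idempotents are central in [E] and sum to one, so rotating one of the
    two copies makes both disappear. *)
Lemma strip_corners a (f : T) : strip a (\sum_i i0 (e i) * f * i0 (e i) : T) = strip a f.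
Proof.
have valsum (u : 'I_n.+1 -> T) : talg_val (\sum_i u i) = \sum_i talg_val (u i).
  by apply: (big_morph (@talg_val F E BM)).
rewrite valsum (strip_sum coords).
under eq_bigr do rewrite !talgM -mulrA (strip_incl0C coords) -mulrA -incl0M idemM eqxx.
by rewrite -(strip_sum coords) -mulr_sumr -incl0_sum sum_idem incl0_1 mulr1.
Qed.

Lemma cyc_derD a g : {morph cyc_der a ^~ g : x y / x + y}.
Proof. by move=> x y; rewrite /cyc_der hT_D talgD (stripD coords). Qed.

Lemma cyc_derM a x y g : cyc_der a (x * y) g = cyc_der a x (y * g) + cyc_der a y (g * x).
Proof. by rewrite /cyc_der hT_M talgD (stripD coords). Qed.

(** Here [hT] is a commutator with [s], up to corners; rotating [s] kills it. *)
Lemma cyc_der_incl0 a s g : cyc_der a (i0 s) g = 0.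
Proof.
rewrite /cyc_der hT_incl0 strip_corners.
rewrite -[talg_val (_ - _)]/(incl0 BM s * (g : FM) - (g : FM) * incl0 BM s).
by rewrite (stripB coords) (strip_incl0C coords) subrr.
Qed.

Lemma cyc_der_incl1 a m g : cyc_der a (tincl1 m) g = cofactor_at La st a m g.
Proof.
have t0 (g' : T) : cyc_der a 0 g' = 0.
  by apply: (addrI (cyc_der a 0 g')); rewrite -cyc_derD !addr0.
have t1D (x y : BM) : tincl1 (x + y) = tincl1 x + tincl1 y :> T.
  by apply: talg_inj; exact: incl1D.
have t1_0 : tincl1 (0 : BM) = 0 :> T by apply: talg_inj; exact: incl1_0.
rewrite -(strip_incl1 coords) [m](coord_id coords).
pose k (x : BM) := cyc_der a (tincl1 x) g = strip a (incl1 x * (g : FM)).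
apply: (big_ind k) => [|x y kx ky|b _].
- by rewrite /k t1_0 t0 incl1_0 mul0r (strip0 coords).
- by rewrite /k t1D cyc_derD kx ky incl1D mulrDl (stripD coords).
apply: (big_ind k) => [|x y kx ky|s _].
- by rewrite /k t1_0 t0 incl1_0 mul0r (strip0 coords).
- by rewrite /k t1D cyc_derD kx ky incl1D mulrDl (stripD coords).
rewrite /k; set t := st b s m.
have -> : tincl1 (ract BM (lact BM s (av b)) t) = i0 s * tincl1 (av b) * i0 t.
  by apply: talg_inj; rewrite [LHS]incl1_ract incl1_lact.
rewrite !cyc_derM !cyc_der_incl0 add0r addr0 /cyc_der hT_incl1 // strip_corners.
rewrite incl1_ract incl1_lact !talgM /= -!mulrA (strip_incl0C coords).
by rewrite !mulrA.
Qed.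

Lemma cyc_der_derivation : cyclic_derivation La st cyc_der.
Proof.
split; [exact: cyc_derD|exact: cyc_der_incl0|exact: cyc_der_incl1|].
exact: cyc_derM.
Qed.

Lemma delta_component (f : FM) l : delta D f l = (hT D (homog f l) 1 : FM) l.
Proof.
rewrite /delta /hF big_ord_recr /= big1 ?add0r.
  by rewrite subnn; congr (talg_val (hT D _ _) l); apply: talg_inj;
     rewrite homogE -[X in X = _]/(hinj (1 : tpow BM 0)) hinj0.
move=> i _; have -> : homog (1 : FM) (l - i) = 0.
  apply: talg_inj; rewrite homogE; have := ltn_ord i; rewrite -subn_gt0.
  by case: (l - i)%N => // k _; rewrite hinj_0.
rewrite /hT; have -> w : TZT_ract (w : TZT M) 0 = 0.
  elim/tensor_ind: w => [|x y|w w' IHw IHw'].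
  - exact: tlift0 (TZT_ract_bal 0).
  - by rewrite /TZT_ract (tlift_tens (TZT_ract_bal 0)) mulr0 tens0r.
  - by rewrite /TZT_ract (tliftD (TZT_ract_bal 0)) -!/(TZT_ract _ _) IHw IHw' addr0.
by rewrite /u_map (tlift0 u_map_bal).
Qed.

(** Component [l] of [strip a f] only sees component [l.+1] of [f], and
    [cyc_der a (homog f i) 1] is homogeneous of degree [i - 1]. *)
Lemma strip_delta a (f : FM) m :
  deg_ge m (strip a (delta D f) - \sum_(i < m.+1) cyc_der a (homog f i) 1).
Proof.
move=> l lm; rewrite dprodDE dprodNE dprod_sumE.
have lm1 : (l.+1 < m.+1)%N by [].
rewrite (bigD1 (Ordinal lm1)) //= big1 => [|i il].
  rewrite addr0 -dprodNE -dprodDE /cyc_der -(stripB coords).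
  apply: (strip_eq0 coords); rewrite dprodDE dprodNE delta_component.
  by rewrite subrr.
rewrite homog_tinj; apply: (cycder_homogeneous cyc_der_derivation a (f i) (d := 0)).
  by case.
by rewrite addn0; apply: contraNneq il => il; apply/eqP/val_inj.
Qed.

End CyclicDerivation.

(** * Coordinates from bases of M0 and E *)

Section BimoduleLinearity.
Variables (F : fieldType) (A B : algType F) (V : lmodType F) (M : bimod_on A B V).

Lemma lactDl a b v : lact M (a + b) v = lact M a v + lact M b v.
Proof. by have := lact_linearl M v 1 a b; rewrite !scale1r. Qed.
Lemma lactDr a v w : lact M a (v + w) = lact M a v + lact M a w.
Proof. by have := lact_linearr M a 1 v w; rewrite !scale1r. Qed.
Lemma ractDl v w b : ract M (v + w) b = ract M v b + ract M w b.
Proof. by have := ract_linearl M b 1 v w; rewrite !scale1r. Qed.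
Lemma ractDr v a b : ract M v (a + b) = ract M v a + ract M v b.
Proof. by have := ract_linearr M v 1 a b; rewrite !scale1r. Qed.

Lemma lact0v v : lact M 0 v = 0.
Proof. by apply: (addrI (lact M 0 v)); rewrite -lactDl !addr0. Qed.
Lemma lactv0 a : lact M a 0 = 0.
Proof. by apply: (addrI (lact M a 0)); rewrite -lactDr !addr0. Qed.
Lemma ract0v b : ract M 0 b = 0.
Proof. by apply: (addrI (ract M 0 b)); rewrite -ractDl !addr0. Qed.
Lemma ractv0 v : ract M v 0 = 0.
Proof. by apply: (addrI (ract M v 0)); rewrite -ractDr !addr0. Qed.

Lemma lactZl c a v : lact M (c *: a) v = c *: lact M a v.
Proof. by have := lact_linearl M v c a 0; rewrite lact0v !addr0. Qed.
Lemma lactZr c a v : lact M a (c *: v) = c *: lact M a v.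
Proof. by have := lact_linearr M a c v 0; rewrite lactv0 !addr0. Qed.
Lemma ractZl c v b : ract M (c *: v) b = c *: ract M v b.
Proof. by have := ract_linearl M b c v 0; rewrite ract0v !addr0. Qed.
Lemma ractZr c v b : ract M v (c *: b) = c *: ract M v b.
Proof. by have := ract_linearr M v c b 0; rewrite ractv0 !addr0. Qed.

Lemma lact_suml (I : Type) (r : seq I) (Q : pred I) (u : I -> A) v :
  lact M (\sum_(j <- r | Q j) u j) v = \sum_(j <- r | Q j) lact M (u j) v.
Proof.
by apply: (big_morph (fun a => lact M a v)) => [a b|];
  [exact: lactDl|exact: lact0v].
Qed.
Lemma lact_sumr (I : Type) (r : seq I) (Q : pred I) a (u : I -> V) :
  lact M a (\sum_(j <- r | Q j) u j) = \sum_(j <- r | Q j) lact M a (u j).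
Proof. by apply: (big_morph (lact M a)) => [v w|]; [exact: lactDr|exact: lactv0]. Qed.
Lemma ract_suml (I : Type) (r : seq I) (Q : pred I) (u : I -> V) b :
  ract M (\sum_(j <- r | Q j) u j) b = \sum_(j <- r | Q j) ract M (u j) b.
Proof.
by apply: (big_morph (fun v => ract M v b)) => [v w|];
  [exact: ractDl|exact: ract0v].
Qed.
Lemma ract_sumr (I : Type) (r : seq I) (Q : pred I) v (u : I -> B) :
  ract M v (\sum_(j <- r | Q j) u j) = \sum_(j <- r | Q j) ract M v (u j).
Proof. by apply: (big_morph (ract M v)) => [a b|]; [exact: ractDr|exact: ractv0]. Qed.

End BimoduleLinearity.

Section Bases.
Variables (F : fieldType) (W : lmodType F) (U : set W) (s : seq W).
Hypothesis sU : is_Fbasis U s.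

Lemma Fbasis_sub w : w \in s -> U w.
Proof. by case: sU => h _; apply: h. Qed.

Lemma Fbasis_span w : U w -> exists c : 'I_(size s) -> F, w = \sum_k c k *: s`_k.
Proof. by case: sU => _ h /h [c [wc _]]; exists c. Qed.

Let single (k : 'I_(size s)) : {ffun 'I_(size s) -> F} := [ffun j => (j == k)%:R].

Let singleE (k : 'I_(size s)) : s`_k = \sum_(j < size s) single k j *: s`_j.
Proof.
rewrite (bigD1 k) //= ffunE eqxx scale1r big1 ?addr0 // => j /negPf jk.
by rewrite ffunE jk scale0r.
Qed.

Lemma Fbasis_unique w (c d : {ffun 'I_(size s) -> F}) : U w ->
  w = \sum_(k < size s) c k *: s`_k -> w = \sum_(k < size s) d k *: s`_k -> c = d.
Proof. by case: sU => _ h /h [c' [_ u]] /u <- /u <-. Qed.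

Lemma Fbasis_uniq : uniq s.
Proof.
apply/(uniqP 0) => i j; rewrite !inE => si sj e.
have Ui : U s`_(Ordinal si) by apply/Fbasis_sub/mem_nth.
have := Fbasis_unique Ui (singleE (Ordinal si)); rewrite /= e.
move=> /(_ (single (Ordinal sj)) (singleE (Ordinal sj))) /ffunP/(_ (Ordinal si)).
rewrite !ffunE eqxx; case: eqP => [[//]|_ /eqP]; by rewrite oner_eq0.
Qed.

Lemma Fbasis_neq0 w : w \in s -> w != 0.
Proof.
move=> ws; apply/eqP => w0; have /(nthP 0) [k sk wk] := ws.
have U0 : U s`_(Ordinal sk) by apply/Fbasis_sub/mem_nth.
have := @Fbasis_unique _ (single (Ordinal sk)) 0 U0 (singleE _).
rewrite /= wk w0 big1 => [|j _]; last by rewrite ffunE scale0r.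
move=> /(_ erefl) /ffunP /(_ (Ordinal sk)); rewrite !ffunE eqxx.
by move/eqP; rewrite oner_eq0.
Qed.

End Bases.

Section FreeCoordinates.
Variables (F : fieldType) (n : nat) (E_ : 'I_n.+1 -> falgType F).
Local Notation E := (prodalg E_).
Local Notation e := (idem E_).
Variables (V : vectType F) (M : bimod_on E E V) (M0 : {vspace V}).
Local Notation BM := (Bimod M).
Variables (A : 'I_n.+1 -> 'I_n.+1 -> seq V) (L : 'I_n.+1 -> seq E).
Variable star : E -> V -> V -> E.
Hypotheses (Mfree : Zfree M M0) (HA : is_M0_basis M M0 A) (HL : is_E_basis L)
  (Hstar : is_dual M A L star).

(** A single finite index type for all the bases [A i j], so that families of
    corrections and sums over the arrows need no bookkeeping of endpoints. *)
Definition arrow : finType :=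
  {p : 'I_n.+1 * 'I_n.+1 & 'I_(size (A p.1 p.2))}.

Definition arrow_val (x : arrow) : V := (A (tag x).1 (tag x).2)`_(tagged x).
Definition arrow_basis (x : arrow) : seq E := L (tag x).1.
Definition arrow_star (x : arrow) (s : E) : V -> E := star s (arrow_val x).

Lemma arrow_mem x : arrow_val x \in A (tag x).1 (tag x).2.
Proof. exact: mem_nth. Qed.

Lemma mem_arrow i j a : a \in A i j -> exists2 x, a = arrow_val x & tag x = (i, j).
Proof.
move=> /(nthP 0) [k sk <-].
by exists (Tagged (fun p : 'I_n.+1 * 'I_n.+1 => 'I_(size (A p.1 p.2)))
  (Ordinal sk : 'I_(size (A (i, j).1 (i, j).2)))).
Qed.

Lemma A_corner i j a : a \in A i j ->
  [/\ a \in M0, lact M (e i) a = a & ract M a (e j) = a].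
Proof.
move=> /(Fbasis_sub (HA i j)) [m0 m0M ->]; have [sub _] := Mfree.
have [eM _] := sub _ _ (idem_Zsub E_ i) m0M.
split; first by have [] := sub _ _ (idem_Zsub E_ j) eM.
  by rewrite -lractA -lactM idemM eqxx.
by rewrite -ractM idemM eqxx.
Qed.

Lemma A_disjoint i j i' j' a : a \in A i j -> a \in A i' j' -> (i, j) = (i', j').
Proof.
move=> aij aij'; have a0 := Fbasis_neq0 (HA i j) aij.
have [_ li rj] := A_corner aij; have [_ li' rj'] := A_corner aij'.
have [<-|ii] := eqVneq i i'; last first.
  by case/eqP: a0; rewrite -li -{1}li' -lactM idemM (negPf ii) lact0v.
have [<-//|jj] := eqVneq j j'.
by case/eqP: a0; rewrite -rj' -{1}rj -ractM idemM (negPf jj) ractv0.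
Qed.

Lemma arrow_inj : injective arrow_val.
Proof.
move=> x y xy; have := A_disjoint (arrow_mem x).
rewrite xy => /(_ _ _ (arrow_mem y)).
rewrite -!surjective_pairing; case: x y xy => [p k] [q l] /= xy pq.
case: q / pq l xy => l xy; congr (Tagged _ _); apply: val_inj.
apply/eqP; rewrite -(nth_uniq 0 (ltn_ord k) (ltn_ord l) (Fbasis_uniq (HA _ _))).
exact/eqP.
Qed.

Lemma L_corner i l : l \in L i -> e i * l = l.
Proof.
by move=> /(Fbasis_sub (HL i)) [y ->]; rewrite mulrA idemM eqxx.
Qed.

Lemma L_span i (y : E) : e i * y = y -> exists c : 'I_(size (L i)) -> F,
  y = \sum_k c k *: (L i)`_k.
Proof. by move=> yi; apply: (Fbasis_span (HL i)); exists y. Qed.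

Lemma star_linear i j a s : a \in A i j -> s \in L i -> right_Elinear M (star s a).
Proof. by move=> aA sL; have [] := Hstar aA sL. Qed.

(** By linearity [y] may be taken in [L i]; then a single coordinate of
    [y a t] is nonzero. A scalar in front of [y] is moved to [t] and back, which
    is what the hypothesis on scalars is for. *)
Lemma star_sum i j a x (y t : E) (W : zmodType) (f : E -> E -> W) :
  a \in A i j -> e i * y = y ->
  (forall y, {morph f^~ y : x x' / x + x'}) ->
  (forall x, {morph f x : y y' / y + y'}) ->
  (forall c x y, f (c *: x) y = f x (c *: y)) ->
  \sum_(s <- arrow_basis x) f (arrow_star x s (ract M (lact M y a) t)) s =
  if a == arrow_val x then f (e j * t) y else 0.
Proof.
move=> aA yi fl fr fZ.
have f0l q : f 0 q = 0 by apply: (addrI (f 0 q)); rewrite -fl !addr0.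
have f0r q : f q 0 = 0 by apply: (addrI (f q 0)); rewrite -fr !addr0.
have main l t' : l \in L i ->
    \sum_(s <- arrow_basis x) f (arrow_star x s (ract M (lact M l a) t')) s =
    if a == arrow_val x then f (e j * t') l else 0.
  move=> lL; have [ax|ax] := eqVneq a (arrow_val x); last first.
    rewrite big_seq big1 // => s sL; have [[_ sR] _ s0] := Hstar (arrow_mem x) sL.
    rewrite /arrow_star sR (s0 i j) ?mul0r //.
    by move=> [_ aE]; rewrite aE eqxx in ax.
  have xij : tag x = (i, j).
    by rewrite (surjective_pairing (tag x)); apply: (@A_disjoint _ _ _ _ a) => //;
       rewrite ax arrow_mem.
  rewrite /arrow_basis xij /= (bigD1_seq l) //=; last exact: Fbasis_uniq (HL i).
  rewrite /arrow_star -ax; have [[_ lR] le _] := Hstar aA lL.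
  rewrite lR le big_seq_cond big1 ?addr0 // => s /andP[sL sl].
  have [[_ sR] _ s0] := Hstar aA sL.
  by rewrite sR (s0 i j) ?mul0r // => -[ls]; rewrite ls eqxx in sl.
have [c yE] := L_span yi.
transitivity (\sum_(k < size (L i)) \sum_(s <- arrow_basis x)
    f (arrow_star x s (ract M (lact M (L i)`_k a) (c k *: t))) s).
  rewrite exchange_big /= big_seq [RHS]big_seq; apply: eq_bigr => s sL.
  have [[sD _] _ _] := Hstar (arrow_mem x) sL.
  have s0 : arrow_star x s 0 = 0.
    by apply: (addrI (arrow_star x s 0)); rewrite -[LHS]sD !addr0.
  rewrite yE lact_suml ract_suml (big_morph (arrow_star x s) sD s0).
  rewrite (big_morph (f^~ s) (fl s) (f0l s)); apply: eq_bigr => k _.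
  by rewrite lactZl ractZl ractZr.
under eq_bigr => k _ do rewrite main ?mem_nth //.
case: ifP => _; last by rewrite big1.
rewrite yE (big_morph _ (fr _) (f0r _)); apply: eq_bigr => k _.
by rewrite -scalerAr fZ.
Qed.

(** The multiplication map is onto, and its left and middle factors can be
    expanded in the chosen bases. *)
Lemma bimod_gen (Q : V -> Prop) : Q 0 -> (forall u v, Q u -> Q v -> Q (u + v)) ->
  (forall x l t, l \in arrow_basis x -> Q (ract M (lact M l (arrow_val x)) t)) ->
  forall m, Q m.
Proof.
move=> Q0 QD Qg m; have [_ [g _ mK]] := Mfree.
rewrite -(mK m) /mult_map /tlift.
apply: (big_ind Q) => // p _; apply: (big_ind Q) => // q _.
move: (p.2) (q.1) (vsval q.2) (subvsP q.2) => t s m0 m0M {p q}.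
have -> : m0 = \sum_i \sum_j ract M (lact M (e i) m0) (e j).
  under eq_bigr do rewrite -ract_sumr sum_idem ract1.
  by rewrite -lact_suml sum_idem lact1.
rewrite lact_sumr ract_suml; apply: (big_ind Q) => // i _.
rewrite lact_sumr ract_suml; apply: (big_ind Q) => // j _.
have [c ->] : exists c : 'I_(size (A i j)) -> F,
    ract M (lact M (e i) m0) (e j) = \sum_k c k *: (A i j)`_k.
  by apply: (Fbasis_span (HA i j)); exists m0.
rewrite lact_sumr ract_suml; apply: (big_ind Q) => // k _.
have aA : (A i j)`_k \in A i j by apply: mem_nth.
have [_ ea _] := A_corner aA.
have [x xE xij] := mem_arrow aA.
rewrite lactZr ractZl -ractZr -ea -lactM.
have [d ->] : exists d : 'I_(size (L i)) -> F, s * e i = \sum_h d h *: (L i)`_h.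
  by apply: L_span; rewrite -idem_central mulrA idemM eqxx.
rewrite lact_suml ract_suml; apply: (big_ind Q) => // h _.
rewrite lactZl ractZl -ractZr xE; apply: Qg.
by rewrite /arrow_basis xij mem_nth.
Qed.

Lemma arrow_coords : @free_coords F E BM arrow arrow_val arrow_basis arrow_star.
Proof.
split.
- by move=> x s sL m m'; have [sD _] := star_linear (arrow_mem x) sL; apply: sD.
- by move=> x s m t sL; have [_ sR] := star_linear (arrow_mem x) sL; apply: sR.
- move=> m; elim/bimod_gen: m => [|u v hu hv|x l t lL].
  + rewrite big1 // => x _; rewrite big_seq big1 // => s sL.
    have [sD _] := star_linear (arrow_mem x) sL.
    have s0 : arrow_star x s 0 = 0.
      by apply: (addrI (arrow_star x s 0)); rewrite -[LHS]sD !addr0.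
    by rewrite s0; exact: ractv0.
  + rewrite {1}hu {1}hv -big_split; apply: eq_bigr => x _ /=.
    rewrite -big_split /= big_seq [RHS]big_seq; apply: eq_bigr => s sL.
    have [sD _] := star_linear (arrow_mem x) sL.
    by rewrite [arrow_star x s (u + v)]sD; apply/esym; exact: ractDr.
  have [_ _ ae] := A_corner (arrow_mem x).
  rewrite (bigD1 x) //= [X in _ + X]big1 ?addr0 => [|y yx].
    rewrite (star_sum (i := (tag x).1) (j := (tag x).2) x t
      (f := fun p q => ract M (lact M q (arrow_val x)) p)).
    * by rewrite eqxx ractM [ract M _ (e _)]lractA ae.
    * exact: arrow_mem.
    * exact: L_corner.
    * by move=> q p p'; exact: ractDr.
    * by move=> p q q'; rewrite lactDl ractDl.
    * by move=> c p q; rewrite ractZr lactZl ractZl.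
  rewrite (star_sum (i := (tag x).1) (j := (tag x).2) y t
      (f := fun p q => ract M (lact M q (arrow_val y)) p)).
  * by rewrite eq_sym; case: eqP => // /arrow_inj yE; rewrite yE eqxx in yx.
  * exact: arrow_mem.
  * exact: L_corner.
  * by move=> q p p'; exact: ractDr.
  * by move=> p q q'; rewrite lactDl ractDl.
  * by move=> c p q; rewrite ractZr lactZl ractZl.
move=> x u m W f fl fr fZ.
have f0l q : f 0 q = 0 by apply: (addrI (f 0 q)); rewrite -fl !addr0.
elim/bimod_gen: m => [|v w hv hw|y l t lL].
- rewrite big_seq [RHS]big_seq; apply: eq_bigr => s sL.
  have [sD _] := star_linear (arrow_mem x) sL.
  have s0 : arrow_star x s 0 = 0.
    by apply: (addrI (arrow_star x s 0)); rewrite -[LHS]sD !addr0.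
  have -> : lact BM u 0 = 0 by exact: lactv0.
  by rewrite s0 !f0l.
- transitivity (\sum_(s <- arrow_basis x) f (arrow_star x s (lact BM u v)) s +
                \sum_(s <- arrow_basis x) f (arrow_star x s (lact BM u w)) s).
    rewrite -big_split big_seq [RHS]big_seq; apply: eq_bigr => s sL.
    have [sD _] := star_linear (arrow_mem x) sL.
    have -> : lact BM u (v + w) = lact BM u v + lact BM u w by exact: lactDr.
    by rewrite [arrow_star x s (_ + _)]sD fl.
  rewrite hv hw -big_split big_seq [RHS]big_seq; apply: eq_bigr => s sL.
  have [sD _] := star_linear (arrow_mem x) sL.
  by rewrite [arrow_star x s (_ + _)]sD fl.
have lE : e (tag y).1 * l = l by exact: L_corner.
have -> : lact BM u (ract M (lact M l (arrow_val y)) t) =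
          ract M (lact M (u * l) (arrow_val y)) t.
  by rewrite lactM [RHS]lractA.
rewrite (star_sum (i := (tag y).1) (j := (tag y).2) x t (f := f)) //; first last.
- by rewrite mulrA idem_central -mulrA lE.
- exact: arrow_mem.
rewrite (star_sum (i := (tag y).1) (j := (tag y).2) x t
  (f := fun p q => f p (u * q))) //.
- exact: arrow_mem.
- by move=> p q q'; rewrite mulrDr fr.
- by move=> c p q; rewrite fZ scalerAr.
Qed.

Lemma fin_span_E : fin_span E.
Proof.
pose s := flatten [seq L i | i <- enum 'I_n.+1]; exists s.
pose Q (w : E) := exists c : nat -> F, w = \sum_(k < size s) c k *: s`_k.
have Q0 : Q 0 by exists (fun=> 0); rewrite big1 // => k _; rewrite scale0r.
have QD u v : Q u -> Q v -> Q (u + v).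
  move=> [c ->] [d ->]; exists (fun k => c k + d k); rewrite -big_split.
  by apply: eq_bigr => k _; rewrite scalerDl.
have Qg c l : l \in s -> Q (c *: l).
  move=> ls; exists (fun k => if k == index l s then c else 0).
  rewrite -index_mem in ls; rewrite (bigD1 (Ordinal ls)) //= eqxx nth_index.
    rewrite big1 ?addr0 // => k kl; case: eqP => [ke|]; last by rewrite scale0r.
    by case/eqP: kl; apply: val_inj.
  by rewrite -index_mem.
move=> w; rewrite -[w]mul1r -(sum_idem E_) mulr_suml; apply: (big_ind Q) => // i _.
have [c ->] := Fbasis_span (HL i) (ex_intro _ w (erefl (e i * w))).
apply: (big_ind Q) => // k _; apply: Qg; apply/flattenP; exists (L i).
  by apply/mapP; exists i => //; rewrite mem_enum.
exact: mem_nth.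
Qed.

Lemma fin_span_V : fin_span V.
Proof.
exists (vbasis (fullv : {vspace V})) => w.
pose c k := if insub k is Some j then coord (vbasis fullv) j w else 0.
exists c; rewrite {1}(coord_vbasis (memvf w)) size_tuple.
by apply: eq_bigr => k _; rewrite /c valK.
Qed.

End FreeCoordinates.

(** * The theorem *)

Theorem proposition5p5
    (F : fieldType) (n : nat) (E_ : 'I_n.+1 -> falgType F)
    (ssE : forall i, semisimple (E_ i))
    (V : vectType F) (M : bimod_on (prodalg E_) (prodalg E_) V)
    (M0 : {vspace V}) (Mfree : Zfree M M0)
    (Delta : talg (Bimod M) -> TZT M) (HDelta : is_Delta M0 Delta)
    (A : 'I_n.+1 -> 'I_n.+1 -> seq V) (HA : is_M0_basis M M0 A)
    (L : 'I_n.+1 -> seq (prodalg E_)) (HL : is_E_basis L)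
    (star : prodalg E_ -> V -> V -> prodalg E_) (Hstar : is_dual M A L star)
    (P P' : ctalg (Bimod M))
    (potP : potential P) (potP' : potential P')
    (P_ge3 : deg_ge 3 P) (P'_ge3 : deg_ge 3 P')
    (PP' : closed_sq (Rideal Delta A L star P) (P' - P)) :
  exists phi : {lrmorphism ctalg (Bimod M) -> ctalg (Bimod M)},
    [/\ bijective phi,
        forall s : prodalg E_, phi (incl0 (Bimod M) s) = incl0 (Bimod M) s,
        cyc_equiv (phi P) P' &
        forall f, Rideal Delta A L star P (phi f - f)].
Proof.
have avM0 (x : arrow A) : arrow_val x \in M0.
  by have [] := A_corner Mfree HA (arrow_mem x).
pose La : arrow A -> seq (prodalg E_) := arrow_basis L.
pose st : arrow A -> prodalg E_ -> Bimod M -> prodalg E_ := arrow_star star.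
pose av : arrow A -> Bimod M := @arrow_val _ _ _ A.
have coords : free_coords av La st := arrow_coords Mfree HA HL Hstar.
pose X (x : arrow A) := Xstar Delta L star (tag x).1 (arrow_val x) P.
pose Z := cyc_der Delta La st.
have HZ : cyclic_derivation La st Z.
  exact: (cyc_der_derivation HDelta coords avM0).
have XZ x k : deg_ge k (X x - \sum_(i < k.+1) Z x (homog P i) 1).
  have -> : X x = strip La st x (delta Delta P) by [].
  exact: (strip_delta HDelta coords avM0).
have X2 x : deg_ge 2 (X x).
  rewrite -[X x](subrK (\sum_(i < 3) Z x (homog P i) 1)).
  apply: deg_geD; first exact: XZ.
  by rewrite big1 // => i _; rewrite homog_tinj P_ge3 // tinj_0 (cycder0 HZ).
have JR f : Jfil X 0 f <-> Rideal Delta A L star P f.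
  split; apply/tclosureS/lspanS.
    move=> _ [_ [_ [x [u [v [_ _ _ ->]]]]]]; exists u, (X x), v; split=> //.
    by exists (tag x).1, (tag x).2, (arrow_val x); split=> //; apply: arrow_mem.
  move=> _ [u [_ [v [[i [j [a [aA ->]]]] ->]]]].
  have [x -> xij] := mem_arrow aA; exists 0%N, 0%N, x, u, v; split=> //.
  by rewrite /X xij.
have [b Jb bP] : exists2 b : arrow A -> ctalg (Bimod M),
    forall x, Jfil X 0 (b x) &
    cyc_equiv (ext (perturb La st b) P) P'.
  apply: (cyc_equiv_deformation coords X2 HZ P_ge3 XZ).
  - exact: fin_span_E HL.
  - exact: fin_span_V.
  apply: tclosureS PP'; apply: lspanS => _ [f [g [Rf Rg ->]]].
  by exists f, g; split=> //; apply/JR.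
set bt := perturb _ _ b in bP.
have bm : bimod_map bt by apply: (J0_bimod coords X2).
pose lin := GRing.isLinear.Build _ _ _ _ (ext bt) (ext_linear bm).
pose mul := GRing.isMonoidMorphism.Build _ _ (ext bt) (conj (ext1 bm) (extM bm)).
pose phi : {lrmorphism ctalg (Bimod M) -> ctalg (Bimod M)} :=
  HB.pack (ext bt) lin mul.
exists phi; split=> [||//|f].
- apply: (ext_bij bm) => m; rewrite /bt /perturb addrC addKr.
  by apply: dev_deg => x; exact: (J_deg X2 (Jb x)).
- exact: (ext_incl0 bm).
- by apply/JR; apply: (ext_sub_J coords X2).
Qed.
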